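(* Suppose that $d\in{}^*\mathbb N$ and $c=2^d\in{}^*\mathbb N\setminus\mathbb N$. If $X\subseteq c\mathbb N$ is a countably determined set, then either $X<_{\mathrm{CD}}c/\mathbb N$ or $X\sim_{\mathrm{CD}}M^d_G$ for some $G\subseteq 2^{\mathbb N}$.
   Context: Work in a fixed countably saturated nonstandard universe; ${}^*\mathbb N$ = hyperintegers, $\mathbb N$ = standard ones; internal sets are elements of the internal universe. A set $X$ is countably determined (CD) if $X=\bigcup_{f\in F}\bigcap_{m\in\mathbb N}X_{f\restriction m}$ for some $F\subseteq2^{\mathbb N}$ and internal sets $X_s$ ($s$ finite binary sequences) with $X_t\subseteq X_s$ for $s\subset t$; a map is CD if its graph is CD. $X\le_{\mathrm{CD}}Y$: there is a CD injection $X\to Y$; $X\sim_{\mathrm{CD}}Y$: both directions; $X<_{\mathrm{CD}}Y$: $X\le_{\mathrm{CD}}Y$ but not $Y\le_{\mathrm{CD}}X$. For $c\in{}^*\mathbb N$: $c\mathbb N=\bigcup_{n\in\mathbb N}[0,cn]$, $c/\mathbb N=\bigcap_{n\ge1}[0,c/n]$. Let $\Xi$ be the internal set of all internal maps $\xi:[0,d)\to\{0,1\}$. For $g\in2^{\mathbb N}$ let $M^d_g=\{\xi\in\Xi:\xi(n)=g(n)\text{ for all }n\in\mathbb N\}$, and for $G\subseteq2^{\mathbb N}$ let $M^d_G=\bigcup_{g\in G}M^d_g$. *)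

(* Defs.v *)
From mathcomp Require Import all_boot all_classical.

Set Implicit Arguments.
Unset Strict Implicit.
Unset Printing Implicit Defensive.

Local Open Scope classical_set_scope.

(* De Bruijn syntax: in [Bex i phi] the bound variable ranges over the members
   of the value of variable [i] and is variable 0 of [phi]. *)
Inductive bformula : Type :=
  | Beq of nat & nat
  | Bin of nat & nat
  | Bnot of bformula
  | Band of bformula & bformula
  | Bex of nat & bformula.

Definition env_cons (T : Type) (x : T) (e : nat -> T) : nat -> T :=
  fun k => if k is k'.+1 then e k' else x.

Fixpoint bsat (T : Type) (mem : T -> T -> Prop) (phi : bformula)
    (e : nat -> T) : Prop :=
  match phi with
  | Beq i j => e i = e j
  | Bin i j => mem (e i) (e j)
  | Bnot p => ~ bsat mem p e
  | Band p q => bsat mem p e /\ bsat mem q e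
  | Bex i p => exists x, mem x (e i) /\ bsat mem p (env_cons x e)
  end.

(* Kuratowski pairs for a membership relation: p = {x, y}, p = {{x}, {x, y}}. *)
Definition upair (T : Type) (mem : T -> T -> Prop) (p x y : T) : Prop :=
  forall z, mem z p <-> z = x \/ z = y.

Definition opair (T : Type) (mem : T -> T -> Prop) (p x y : T) : Prop :=
  exists a b, [/\ upair mem a x x, upair mem b x y & upair mem p a b].

(* V_0 = the individuals, V_{n+1} = V_n together with all subsets of V_n. *)
Fixpoint rank_le (B T : Type) (mem : T -> T -> Prop) (atom : B -> T) (n : nat)
    : set T :=
  match n with
  | 0 => range atom
  | m.+1 => rank_le mem atom m `|`
      [set x | ~ range atom x /\ forall y, mem y x -> rank_le mem atom m y]
  end.

(* [sfull] says that every subset of V_n is an element; with the other fields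
   this determines the superstructure over [sbase] up to isomorphism. *)
Record superstructure : Type := Superstructure {
  sbase : Type;
  snat : nat -> sbase;
  selt :> Type;
  smem : selt -> selt -> Prop;
  satom : sbase -> selt;
  snat_inj : injective snat;
  satom_inj : injective satom;
  satom_nomem : forall b x, ~ smem x (satom b);
  sext : forall x y, ~ range satom x -> ~ range satom y ->
    (forall z, smem z x <-> smem z y) -> x = y;
  srank : forall x, exists n, rank_le smem satom n x;
  sfull : forall n (A : set selt), A `<=` rank_le smem satom n ->
    exists a, ~ range satom a /\ forall x, smem x a <-> A x
}.

Record nonstandard_universe (V : superstructure) : Type := NonstandardUniverse {
  ielt :> Type;
  imem : ielt -> ielt -> Prop;
  star : V -> ielt;
  transfer : forall (phi : bformula) (e : nat -> V),
    bsat (@smem V) phi e <-> bsat imem phi (star \o e);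
  internal_bounded : forall x : ielt, exists a : V, imem x (star a)
}.

Section Nonstandard.
Variables (V : superstructure) (I : nonstandard_universe V).
Implicit Types (x y p d c : I) (X Y A : set I).

(* The star-image of a set of the superstructure given by its extension. *)
Definition star_set (S : set V) : set I :=
  [set x | exists a : V, [/\ ~ range (@satom V) a,
                             forall v : V, smem v a <-> S v
                           & imem x (star I a)]].

Definition is_iset x : Prop := ~ star_set (range (@satom V)) x.

Definition internal A : Prop :=
  exists a : I, is_iset a /\ A = [set x | imem x a].

Definition countably_saturated : Prop :=
  forall A_ : nat -> set I, (forall n, internal (A_ n)) ->
    (forall n, (\bigcap_(i in [set i | (i <= n)%N]) A_ i) !=set0) ->
    (\bigcap_i A_ i) !=set0.

Definition vnat (n : nat) : V := satom (snat V n).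

Definition std (n : nat) : I := star I (vnat n).

Definition hnat : set I := star_set (range vnat).

(* The star-image of a binary relation on nat. *)
Definition star_rel (R : nat -> nat -> Prop) x y : Prop :=
  exists2 p, opair (@imem V I) p x y &
    star_set [set q | exists m n, R m n /\ opair (@smem V) q (vnat m) (vnat n)] p.

(* The star-image of f : nat -> nat, as its graph. *)
Definition star_fun (f : nat -> nat) x y : Prop :=
  star_rel (fun m n => n = f m) x y.

Definition hle x y : Prop := star_rel (fun m n => (m <= n)%N) x y.

Definition hlt x y : Prop := star_rel (fun m n => (m < n)%N) x y.

Definition hpow2 d c : Prop := star_fun (fun m => (2 ^ m)%N) d c.

Definition hseg y : set I := [set x | hle x y].

Definition hseg_mul c (n : nat) : set I :=
  [set x | exists2 y, star_fun (fun m => (m * n)%N) c y & hseg y x].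

(* [0, c / n] for standard n > 0: an integer is below c / n iff it is below the
   integer part of c / n. *)
Definition hseg_div c (n : nat) : set I :=
  [set x | exists2 y, star_fun (fun m => (m %/ n)%N) c y & hseg y x].

Definition cmulN c : set I := \bigcup_n hseg_mul c n.

Definition cdivN c : set I := \bigcap_(n in [set n | (1 <= n)%N]) hseg_div c n.

(* [mkseq f m] is the restriction of f to m. *)
Definition CD X : Prop :=
  exists (F : set (nat -> bool)) (X_ : seq bool -> set I),
    [/\ forall s, internal (X_ s),
        forall s t, prefix s t -> X_ t `<=` X_ s
      & X = \bigcup_(f in F) \bigcap_m X_ (mkseq f m)].

Definition graph_on X (f : I -> I) : set I :=
  [set p | exists2 x, X x & opair (@imem V I) p x (f x)].

Definition CD_le X Y : Prop :=
  exists f : I -> I, [/\ set_fun X Y f, set_inj X f & CD (graph_on X f)].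

Definition CD_equiv X Y : Prop := CD_le X Y /\ CD_le Y X.

Definition CD_lt X Y : Prop := CD_le X Y /\ ~ CD_le Y X.

Definition iapp (xi x y : I) : Prop :=
  exists2 p, opair (@imem V I) p x y & imem p xi.

Definition Xi d : set I :=
  [set xi | [/\ is_iset xi,
     forall p, imem p xi -> exists x y,
       [/\ opair (@imem V I) p x y, hlt x d & y = std 0 \/ y = std 1]
   & forall x, hlt x d -> exists! y, iapp xi x y]].

Definition Mpoint d (g : nat -> bool) : set I :=
  [set xi | Xi d xi /\ forall n : nat, iapp xi (std n) (std (nat_of_bool (g n)))].

Definition Mset d (G : set (nat -> bool)) : set I := \bigcup_(g in G) Mpoint d g.

End Nonstandard.

(* Main.v *)
(* Transfer is used only through the functor [Star]: a standard function
   [T -> U] extends to the star-extensions, compatibly with composition,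
   products and [bool], which gives the transfer principle for arbitrary
   standard predicates ([holds]).  A set is countably determined iff membership
   depends only on the trace of the point on countably many internal sets.

   Put c = 2^d.  First, cN embeds into [0, c): the standard digits of x mod c
   form an element of 2^N, and with a Vitali transversal of tail equality one
   can encode the quotient x / c and the finite discrepancy from the transversal
   by flipping a single digit.  So let X be contained in [0, c), determined by
   internal sets B_n.  By saturation an internal permutation sorts [0, c) by the
   lexicographic order of the traces on B_0, ..., B_(n-1) simultaneously for all
   standard n, so that X is determined by nondecreasing internal functions with
   standardly many values.  Let E be the set of points whose distance to some
   jump of these functions, or to some multiple of 2^(d-k), lies in c/N.  If x
   is in X but not in E, then X contains every point with the same standard digits
   as x, and x + c/N consists of such points.  As E is a countable union of
   halos, it can be absorbed into x + c/N.  Hence X is equivalent to the set of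
   points with digits in some G, unless X is contained in E, in which case X
   embeds into c/N, which is the set of points whose standard digits vanish. *)
Require Import Defs.
From mathcomp Require Import all_boot all_classical.
From mathcomp Require Import zify.

Set Implicit Arguments.
Unset Strict Implicit.
Unset Printing Implicit Defensive.

Local Open Scope classical_set_scope.

(** * Coded transfer and encodings *)

(** The language is enriched with pairing, disjunction, implication and universal quantifiers so
    that transferred sentences can be written directly; [bform] reduces it classically to the
    bounded formulas of the transfer axiom. *)
Inductive xformula : Type :=
  | Xeq of nat & nat
  | Xin of nat & nat
  | Xpair of nat & nat & nat
  | Xnot of xformula
  | Xand of xformula & xformula
  | Xor of xformula & xformula
  | Ximp of xformula & xformula
  | Xall of nat & xformula
  | Xex of nat & xformula.

Fixpoint xsat (T : Type) (mem : T -> T -> Prop) (phi : xformula)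
    (e : nat -> T) : Prop :=
  match phi with
  | Xeq i j => e i = e j
  | Xin i j => mem (e i) (e j)
  | Xpair p x y => opair mem (e p) (e x) (e y)
  | Xnot p => ~ xsat mem p e
  | Xand p q => xsat mem p e /\ xsat mem q e
  | Xor p q => xsat mem p e \/ xsat mem q e
  | Ximp p q => xsat mem p e -> xsat mem q e
  | Xall i p => forall x, mem x (e i) -> xsat mem p (env_cons x e)
  | Xex i p => exists x, mem x (e i) /\ xsat mem p (env_cons x e)
  end.

Definition Bor p q := Bnot (Band (Bnot p) (Bnot q)).
Definition Ball i p := Bnot (Bex i (Bnot p)).

Definition Bupair p x y :=
  Band (Bin x p) (Band (Bin y p) (Ball p (Bor (Beq 0 x.+1) (Beq 0 y.+1)))).

(** The two Kuratowski components are members of [p], so their quantifiers can be bounded by [p];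
    under the two binders they are the variables 1 and 0. *)
Definition Bopair p x y :=
  Bex p (Bex p.+1 (Band (Bupair 1 x.+2 x.+2)
    (Band (Bupair 0 x.+2 y.+2) (Bupair p.+2 1 0)))).

Fixpoint bform (phi : xformula) : bformula :=
  match phi with
  | Xeq i j => Beq i j
  | Xin i j => Bin i j
  | Xpair p x y => Bopair p x y
  | Xnot p => Bnot (bform p)
  | Xand p q => Band (bform p) (bform q)
  | Xor p q => Bor (bform p) (bform q)
  | Ximp p q => Bor (Bnot (bform p)) (bform q)
  | Xall i p => Ball i (bform p)
  | Xex i p => Bex i (bform p)
  end.

Lemma bsat_or T (mem : T -> T -> Prop) p q e :
  bsat mem (Bor p q) e <-> bsat mem p e \/ bsat mem q e.
Proof. by rewrite /=; split=> [/not_andP[/contrapT|/contrapT]|[]]; tauto. Qed.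

Lemma bsat_all T (mem : T -> T -> Prop) i p e :
  bsat mem (Ball i p) e <->
  forall x, mem x (e i) -> bsat mem p (env_cons x e).
Proof.
split=> /= [h x xi|h [x [xi]]]; last by apply; exact: h.
by apply: contrapT => np; apply: h; exists x.
Qed.

Lemma bsat_upair T (mem : T -> T -> Prop) p x y e :
  bsat mem (Bupair p x y) e <-> upair mem (e p) (e x) (e y).
Proof.
split=> [[xp [yp h]] z|h].
  split=> [zp|[->|->]//].
  have h' := (bsat_all mem p (Bor (Beq 0 x.+1) (Beq 0 y.+1)) e).1 h z zp.
  exact: (bsat_or mem _ _ _).1 h'.
split; first by apply/h; left.
split; first by apply/h; right.
apply: (bsat_all mem p (Bor (Beq 0 x.+1) (Beq 0 y.+1)) e).2 => z /h zxy.
exact: (bsat_or mem _ _ _).2.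
Qed.

Lemma bsat_opair T (mem : T -> T -> Prop) p x y e :
  bsat mem (Bopair p x y) e <-> opair mem (e p) (e x) (e y).
Proof.
split=> [[a [ap [b [bp [/bsat_upair h1 [/bsat_upair h2 /bsat_upair h3]]]]]]|].
  by exists a, b.
move=> [a [b [h1 h2 h3]]]; exists a; split; first by apply/h3; left.
exists b; split; first by apply/h3; right.
by split; [|split]; apply/bsat_upair.
Qed.

Lemma bsat_bform T (mem : T -> T -> Prop) phi e :
  bsat mem (bform phi) e <-> xsat mem phi e.
Proof.
elim: phi e => //=.
- by move=> p x y e; exact: bsat_opair.
- by move=> p IH e; rewrite IH.
- by move=> p IHp q IHq e; rewrite IHp IHq.
- move=> p IHp q IHq e; rewrite -IHp -IHq; exact: (@bsat_or T mem).
- move=> p IHp q IHq e; rewrite -IHp -IHq.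
  rewrite (_ : (~ _) <-> bsat mem (Bor (Bnot (bform p)) (bform q)) e) //.
  rewrite bsat_or /=; split=> [[]//|h].
  by have [/h|] := pselect (bsat mem (bform p) e); [right|left].
- move=> i p IH e; rewrite (_ : (~ _) <-> bsat mem (Ball i (bform p)) e) //.
  by rewrite bsat_all; split=> h x xi; apply/IH; exact: h.
- by move=> i p IH e; split=> -[x [xi /IH h]]; exists x.
Qed.

Lemma upair_inj T (mem : T -> T -> Prop) p x y x' y' :
  upair mem p x y -> upair mem p x' y' ->
  (x = x' /\ y = y') \/ (x = y' /\ y = x').
Proof.
move=> h h'.
have /h'[ex|ex] : mem x p by apply/h; left.
- have /h'[ey|ey] : mem y p by apply/h; right.
  + have /h[|->] : mem y' p by apply/h'; right.
      by move=> ->; rewrite ey ex; left.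
    by left.
  + by left.
- have /h'[ey|ey] : mem y p by apply/h; right.
  + by right.
  + have /h[->|->] : mem x' p by apply/h'; left.
      by rewrite ey -ex; left.
    by right.
Qed.

Lemma opair_inj T (mem : T -> T -> Prop) p x y x' y' :
  opair mem p x y -> opair mem p x' y' -> x = x' /\ y = y'.
Proof.
move=> [a [b [ha hb hp]]] [a' [b' [ha' hb' hp']]].
have [[ea eb]|[ea eb]] := upair_inj hp hp'; subst.
  have [[ex _]|[ex _]] := upair_inj ha ha'; subst;
    by have [[? ?]|[? ?]] := upair_inj hb hb'; subst.
have [[ex _]|[ex _]] := upair_inj ha hb'; subst;
  have [[? ?]|[? ?]] := upair_inj hb ha'; subst => //;
  by have [[? ?]|[? ?]] := upair_inj ha hb'; subst.
Qed.

Section Codes.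
Variable V : superstructure.

Definition bounded (A : set V) :=
  exists n, A `<=` rank_le (@smem V) (@satom V) n.

(** The value [vnat V 0] is a dummy, taken only when no element of the superstructure has extension
    [A]. *)
Definition code (A : set V) : V :=
  if pselect (exists a, ~ range (@satom V) a /\ forall x, smem x a <-> A x)
    is left h then projT1 (cid h) else vnat V 0.

Lemma codeP A : bounded A ->
  ~ range (@satom V) (code A) /\ forall x, smem x (code A) <-> A x.
Proof.
move=> [n /sfull h]; rewrite /code; case: pselect => // h'.
by case: (cid h').
Qed.

Lemma mem_code A x : bounded A -> smem x (code A) <-> A x.
Proof. by move=> /codeP[_]. Qed.

Lemma rank_leW n m : (n <= m)%N ->
  rank_le (@smem V) (@satom V) n `<=` rank_le (@smem V) (@satom V) m.
Proof.
elim: m => [|m IH]; first by rewrite leqn0 => /eqP ->.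
by rewrite leq_eqVlt => /orP[/eqP->//|/IH h] x /h xm; left.
Qed.

Lemma rank_code A n : A `<=` rank_le (@smem V) (@satom V) n ->
  rank_le (@smem V) (@satom V) n.+1 (code A).
Proof.
move=> An; have [|h1 h2] := @codeP A; first by exists n.
by right; split=> // y /h2; exact: An.
Qed.

Lemma upair_code x y : upair (@smem V) (code [set x; y]) x y.
Proof.
have [n xn] := srank x; have [m ym] := srank y.
move=> z; rewrite mem_code //; exists (maxn n m) => w [->|->].
  by apply: rank_leW xn; rewrite leq_maxl.
by apply: rank_leW ym; rewrite leq_maxr.
Qed.

Definition kpair (x y : V) := code [set code [set x; x]; code [set x; y]].

Lemma opair_kpair x y : opair (@smem V) (kpair x y) x y.
Proof.
by exists (code [set x; x]), (code [set x; y]); split; exact: upair_code.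
Qed.

Lemma rank_kpair n x y : rank_le (@smem V) (@satom V) n x ->
  rank_le (@smem V) (@satom V) n y ->
  rank_le (@smem V) (@satom V) n.+2 (kpair x y).
Proof.
move=> xn yn; apply: rank_code => z [->|->]; apply: rank_code => w [->|->] //.
Qed.

Lemma upair_uniq p q x y :
  upair (@smem V) p x y -> upair (@smem V) q x y -> p = q.
Proof.
move=> hp hq; apply: sext; last by move=> z; rewrite hp hq.
- by move=> [b _ bp]; apply: (@satom_nomem V b x); rewrite bp hp; left.
- by move=> [b _ bp]; apply: (@satom_nomem V b x); rewrite bp hq; left.
Qed.

Lemma opair_uniq p q x y :
  opair (@smem V) p x y -> opair (@smem V) q x y -> p = q.
Proof.
move=> [a [b [ha hb hp]]] [a' [b' [ha' hb' hq]]].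
move: hp hq; rewrite (upair_uniq ha ha') (upair_uniq hb hb').
exact: upair_uniq.
Qed.

Lemma opairE p x y : opair (@smem V) p x y <-> p = kpair x y.
Proof.
split=> [h|->]; last exact: opair_kpair.
exact: opair_uniq h (opair_kpair x y).
Qed.

Lemma kpair_inj x y x' y' : kpair x y = kpair x' y' -> x = x' /\ y = y'.
Proof.
move=> e; apply: (@opair_inj _ (@smem V) (kpair x y)); first exact: opair_kpair.
by rewrite e; exact: opair_kpair.
Qed.

(** The bound on the rank makes the whole image an element of the superstructure, which therefore
    has a star-image. Pairs and sets are encoded below by genuine pairs and sets, so that the
    star-extensions match the set-theoretic definitions. *)
Class encodable (T : Type) := Encodable {
  enc : T -> V;
  enc_inj : injective enc;
  enc_bounded : bounded (range enc) }.

Lemma bounded_sub (A B : set V) : A `<=` B -> bounded B -> bounded A.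
Proof. by move=> AB [n Bn]; exists n; exact: subset_trans Bn. Qed.

Program Definition encodable_inj T U (f : T -> U) (fi : injective f)
  (eU : encodable U) : encodable T := {| enc := enc \o f |}.
Next Obligation. by move=> T U f fi eU; exact: inj_comp enc_inj fi. Qed.
Next Obligation.
move=> T U f _ eU; apply: bounded_sub enc_bounded => _ [t _ <-].
by exists (f t).
Qed.

#[global] Program Instance encodable_nat : encodable nat := {| enc := vnat V |}.
Next Obligation. by move=> m n /satom_inj/snat_inj. Qed.
Next Obligation. by exists 0 => _ [n _ <-]; exists (snat V n). Qed.

Lemma nat_of_bool_inj : injective nat_of_bool.
Proof. by case; case. Qed.

#[global] Instance encodable_bool : encodable bool :=
  encodable_inj nat_of_bool_inj _.

#[global] Program Instance encodable_prod T U (eT : encodable T)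
  (eU : encodable U) : encodable (T * U) :=
  {| enc := fun p => kpair (enc p.1) (enc p.2) |}.
Next Obligation.
move=> T U eT eU [a b] [a' b'] /= /kpair_inj[h1 h2].
by rewrite (enc_inj h1) (enc_inj h2).
Qed.
Next Obligation.
move=> T U [? ? [n hn]] [? ? [m hm]]; exists (maxn n m).+2 => _ [[a b] _ <-] /=.
apply: rank_kpair.
  by apply: (@rank_leW n); [rewrite leq_maxl|apply: hn; exists a].
by apply: (@rank_leW m); [rewrite leq_maxr|apply: hm; exists b].
Qed.

Lemma mem_code_img T {eT : encodable T} (A : set T) x :
  smem x (code (enc @` A)) <-> (enc @` A) x.
Proof.
apply: mem_code; apply: bounded_sub enc_bounded => _ [t _ <-].
by exists t.
Qed.

Lemma mem_code_enc T {eT : encodable T} (A : set T) t :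
  smem (enc t) (code (enc @` A)) <-> A t.
Proof.
by rewrite mem_code_img; split=> [[u Au h]|At]; [rewrite -(enc_inj h)|exists t].
Qed.

#[global] Program Instance encodable_set T (eT : encodable T) :
  encodable (set T) := {| enc := fun A => code (enc @` A) |}.
Next Obligation.
move=> T eT A B e; apply/funext => t; apply/propext.
have hA := mem_code_enc (eT := eT) A t; have hB := mem_code_enc (eT := eT) B t.
have {}e : code (enc @` A) = code (enc @` B) := e.
by rewrite -hA -hB e.
Qed.
Next Obligation.
move=> T [e ei [n hn]] /=; exists n.+1 => _ [A _ <-]; apply: rank_code.
by move=> _ [t _ <-]; apply: hn; exists t.
Qed.

Lemma graph_inj T U : injective (fun (f : T -> U) => [set p | p.2 = f p.1]).
Proof.
move=> f g e; apply/funext => t.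
by have : [set p | p.2 = f p.1] (t, f t) by []; rewrite e.
Qed.

#[global] Instance encodable_fun T U (eT : encodable T) (eU : encodable U) :
  encodable (T -> U) := encodable_inj (@graph_inj T U) _.

Definition univ T {eT : encodable T} : V := code (range (@enc T eT)).
Arguments univ T {eT}.

Lemma mem_univ T {eT : encodable T} x : @smem V x (univ T) <-> range enc x.
Proof. exact/mem_code/enc_bounded. Qed.

Definition graph_code T U {eT : encodable T} {eU : encodable U} (f : T ->
  U) : V :=
  code (range (fun t => enc (t, f t))).

Lemma mem_graph_code T U {eT : encodable T} {eU : encodable U} (f : T -> U) p :
  smem p (graph_code f) <-> exists t, p = kpair (enc t) (enc (f t)).
Proof.
rewrite mem_code; last first.
  apply: bounded_sub (@enc_bounded (T * U)%type _) => _ [t _ <-].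
  by exists (t, f t).
by split=> [[t _ <-]|[t ->]]; exists t.
Qed.

End Codes.
Arguments univ {V} T {eT}.
Arguments enc {V T _} _.

(** * Star-extensions *)

Section Star.
Variables (V : superstructure) (I : nonstandard_universe V).

Lemma xtransfer phi (e : nat -> V) :
  xsat (@smem V) phi e -> xsat (@imem V I) phi (star I \o e).
Proof. by move=> /bsat_bform/transfer/bsat_bform. Qed.

Definition env (l : seq V) : nat -> V := nth (vnat V 0) l.

Definition Star T {eT : encodable V T} : Type :=
  {x : I | imem x (star I (univ T))}.
Arguments Star T {eT}.

Lemma StarP T {eT : encodable V T} (x : Star T) :
  imem (sval x) (star I (univ T)).
Proof. by case: x. Qed.

Lemma val_Star_inj T {eT : encodable V T} (x y : Star T) :
  sval x = sval y -> x = y.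
Proof. by case: x y => x hx [y hy] /= e; exact: eq_exist. Qed.

Lemma graph_code_kpair {T U : Type} {eT : encodable V T} {eU : encodable V U}
  (f : T -> U) t : smem (kpair (enc t) (enc (f t))) (graph_code f).
Proof. by apply/mem_graph_code; exists t. Qed.

Lemma mem_graph_code_pair {T U : Type} {eT : encodable V T} {eU : encodable V U}
  (f : T -> U) t p y :
  smem p (graph_code f) -> opair (@smem V) p (enc t) y -> y = enc (f t).
Proof.
move=> /mem_graph_code[u ->] /opairE/kpair_inj[h <-].
by rewrite (enc_inj h).
Qed.

Section Maps.
Context {T U : Type} {eT : encodable V T} {eU : encodable V U}.

Definition smap_rel (f : T -> U) (x y : I) :=
  exists2 p, opair (@imem V I) p x y & imem p (star I (graph_code f)).

Lemma smap_rel_total (f : T -> U) (x : Star T) :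
  exists y : Star U, smap_rel f (sval x) (sval y).
Proof.
(* In all these sentences the list given to [env] holds the parameters, and under [k] quantifiers
   parameter [j] has index [j + k]. *)
pose proof (@xtransfer (Xall 0 (Xex 2 (Xex 4 (Xpair 0 2 1))))
  (env [:: univ T; univ U; graph_code f])) as tr; move: tr.
rewrite /= => /(_ _ _ (StarP x))[|y [yU [p [pf h]]]].
  move=> _ /mem_univ[t _ <-]; exists (enc (f t)).
  split; first by apply/mem_univ; exists (f t).
  by exists (kpair (enc t) (enc (f t))); split;
    [exact: graph_code_kpair|exact: opair_kpair].
by exists (exist _ y yU), p.
Qed.

Lemma smap_rel_fun (f : T -> U) (x : Star T) (y y' : Star U) :
  smap_rel f (sval x) (sval y) -> smap_rel f (sval x) (sval y') -> y = y'.
Proof.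
move=> [p pxy pf] [q qxy qf]; apply: val_Star_inj; move: qf qxy.
pose proof (@xtransfer (Xall 0 (Xall 2 (Xall 3 (Xall 5 (Xall 6
  (Ximp (Xpair 1 4 3) (Ximp (Xpair 0 4 2) (Xeq 3 2))))))))
  (env [:: univ T; univ U; graph_code f])) as tr; move: tr.
rewrite /= => h qf; apply: h pxy => //; try exact: StarP.
move=> _ /mem_univ[t _ <-] _ /mem_univ[u _ <-] _ /mem_univ[u' _ <-].
by move=> r rf s sf /(mem_graph_code_pair rf)-> /(mem_graph_code_pair sf)->.
Qed.

Definition smap (f : T -> U) (x : Star T) : Star U :=
  sval (cid (smap_rel_total f x)).

Lemma smapP f x y : smap f x = y <-> smap_rel f (sval x) (sval y).
Proof.
rewrite /smap; case: cid => /= z xz; split=> [<-//|]; exact: smap_rel_fun.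
Qed.

Lemma smap_cst u x (y : Star U) : sval y = star I (enc u) ->
  smap (fun=> u) x = y.
Proof.
move=> yu; have /smapP[p] : smap (fun=> u) x = smap (fun=> u) x by [].
set z := smap _ x => pxz pf; apply: val_Star_inj; rewrite yu.
pose proof (@xtransfer (Xall 0 (Xall 2 (Xall 4 (Ximp (Xpair 0 2 1) (Xeq 1 6)))))
  (env [:: univ T; univ U; graph_code (fun _ : T => u); enc u])) as tr; move: tr.
rewrite /= => h; apply: h pxz => //; try exact: StarP.
move=> _ /mem_univ[t _ <-] _ /mem_univ[u' _ <-] r rf.
by move=> /(mem_graph_code_pair rf).
Qed.

Lemma spair_ex (x : Star T) (y : Star U) :
  exists p : Star (T * U), opair (@imem V I) (sval p) (sval x) (sval y).
Proof.
pose proof (@xtransfer (Xall 0 (Xall 2 (Xex 4 (Xpair 0 2 1))))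
  (env [:: univ T; univ U; univ (T * U)%type])) as tr; move: tr.
rewrite /= => h.
have [|p [pP pxy]] := h _ _ (StarP x) _ (StarP y); last by exists (exist _ p pP).
move=> _ /mem_univ[t _ <-] _ /mem_univ[u _ <-]; exists (enc (t, u)).
by split; [apply/mem_univ; exists (t, u)|exact: opair_kpair].
Qed.

Lemma spair_uniq (x : Star T) (y : Star U) p q :
  opair (@imem V I) p (sval x) (sval y) ->
  opair (@imem V I) q (sval x) (sval y) -> p = q.
Proof.
move=> hp hq; have [a pa] := internal_bounded p;
  have [b qb] := internal_bounded q.
pose proof (@xtransfer (Xall 0 (Xall 2 (Xall 4 (Xall 6
  (Ximp (Xpair 3 1 0) (Ximp (Xpair 2 1 0) (Xeq 3 2)))))))
  (env [:: a; b; univ T; univ U])) as tr; move: tr.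
rewrite /= => h; apply: h hp hq => //; try exact: StarP.
by move=> r _ s _ t _ u _; exact: opair_uniq.
Qed.

Lemma spair_dec (p : Star (T * U)) :
  exists x : Star T, exists y : Star U,
  opair (@imem V I) (sval p) (sval x) (sval y).
Proof.
pose proof (@xtransfer (Xall 0 (Xex 2 (Xex 4 (Xpair 2 1 0))))
  (env [:: univ (T * U)%type; univ T; univ U])) as tr; move: tr.
rewrite /= => /(_ _ _ (StarP p))[|x [xT [y [yU h]]]]; last first.
  by exists (exist _ x xT), (exist _ y yU).
move=> _ /mem_univ[[t u] _ <-]; exists (enc t); split.
  by apply/mem_univ; exists t.
exists (enc u); split; first by apply/mem_univ; exists u.
exact: opair_kpair.
Qed.

Definition spair (x : Star T) (y : Star U) := sval (cid (spair_ex x y)).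

Lemma spairP x y p : opair (@imem V I) p (sval x) (sval y) <->
  p = sval (spair x y).
Proof.
rewrite /spair; case: cid => /= q qxy; split=> [pxy|->//].
exact: spair_uniq pxy qxy.
Qed.

End Maps.

Section MapTheory.
Context {T U W : Type} {eT : encodable V T} {eU : encodable V U}
  {eW : encodable V W}.

Lemma smap_comp (f : T -> U) (g : U -> W) x : smap g (smap f x) = smap (g \o f) x.
Proof.
apply/esym/smapP.
set y := smap f x; set z := smap g y.
have [p pxy pf] : smap_rel f (sval x) (sval y) by exact/smapP.
have [q qyz qg] : smap_rel g (sval y) (sval z) by exact/smapP.
pose proof (@xtransfer (Xall 0 (Xall 2 (Xall 4 (Xall 6 (Xall 8
   (Ximp (Xpair 1 4 3) (Ximp (Xpair 0 3 2) (Xex 10 (Xpair 0 5 3)))))))))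
  (env [:: univ T; univ U; univ W; graph_code f; graph_code g;
    graph_code (g \o f)])) as tr; move: tr.
rewrite /= => h.
have [|r [hr rxz]] := h _ _ (StarP x) _ (StarP y) _ (StarP z) _ pf _ qg pxy qyz.
  move=> _ /mem_univ[t _ <-] y1 _ z1 _ p1 p1f q1 q1g.
  move=> /(mem_graph_code_pair p1f)-> /(mem_graph_code_pair q1g)->.
  exists (kpair (enc t) (enc (g (f t)))).
  by split; [exact: (graph_code_kpair (g \o f))|exact: opair_kpair].
by exists r.
Qed.

Lemma smap_id (f : T -> T) (x : Star T) : f =1 id -> smap f x = x.
Proof.
move=> fid.
set y := smap f x.
have [p pxy pf] : smap_rel f (sval x) (sval y) by exact/smapP.
apply: val_Star_inj.
pose proof (@xtransfer (Xall 0 (Xall 1 (Xall 3 (Ximp (Xpair 0 2 1) (Xeq 1 2)))))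
  (env [:: univ T; graph_code f])) as tr; move: tr.
rewrite /= => h; apply: h pxy => //; try exact: StarP.
move=> _ /mem_univ[t _ <-] y1 _ p1 p1f /(mem_graph_code_pair p1f)->.
by rewrite fid.
Qed.

Lemma smap_fst (x : Star T) (y : Star U) : smap fst (spair x y) = x.
Proof.
have pxy := (spairP x y _).2 erefl.
have [q qf hq] : smap_rel (@fst T U) (sval (spair x y)) (sval (smap fst (spair
  x y))).
  by apply: (smapP _ _ _).1.
apply: val_Star_inj; move: hq qf pxy.
pose proof (@xtransfer (Xall 0 (Xall 2 (Xall 4 (Xall 4 (Xall 7
  (Ximp (Xpair 0 4 1) (Ximp (Xpair 4 3 2) (Xeq 1 3))))))))
  (env [:: univ (T * U)%type; univ T; univ U; graph_code (@fst T U)])) as tr;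
    move: tr.
rewrite /= => h; apply: h; try exact: StarP.
move=> _ /mem_univ[[t u] _ <-] x1 _ y1 _ x2 _ p1 p1f.
by move=> /(mem_graph_code_pair p1f)-> /opairE/kpair_inj[].
Qed.

Lemma smap_snd (x : Star T) (y : Star U) : smap snd (spair x y) = y.
Proof.
have pxy := (spairP x y _).2 erefl.
have [q qf hq] : smap_rel (@snd T U) (sval (spair x y)) (sval (smap snd (spair
  x y))).
  by apply: (smapP _ _ _).1.
apply: val_Star_inj; move: hq qf pxy.
pose proof (@xtransfer (Xall 0 (Xall 2 (Xall 4 (Xall 5 (Xall 7
  (Ximp (Xpair 0 4 1) (Ximp (Xpair 4 3 2) (Xeq 1 2))))))))
  (env [:: univ (T * U)%type; univ T; univ U; graph_code (@snd T U)])) as tr;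
    move: tr.
rewrite /= => h; apply: h; try exact: StarP.
move=> _ /mem_univ[[t u] _ <-] x1 _ y1 _ x2 _ p1 p1f.
by move=> /(mem_graph_code_pair p1f)-> /opairE/kpair_inj[].
Qed.

Lemma spairE (p : Star (T * U)) : spair (smap fst p) (smap snd p) = p.
Proof.
have [x [y h]] := spair_dec p.
have -> : p = spair x y by apply/val_Star_inj/spairP.
by rewrite smap_fst smap_snd.
Qed.

Lemma star_enc_proof (t : T) : imem (star I (enc t)) (star I (univ T)).
Proof.
pose proof (@xtransfer (Xin 0 1) (env [:: enc t; univ T])) as tr; move: tr; apply.
by apply/mem_univ; exists t.
Qed.

Definition st (t : T) : Star T := exist _ (star I (enc t)) (star_enc_proof t).

End MapTheory.

Lemma smap_const T U {eT : encodable V T} {eU : encodable V U} (u : U)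
  (x : Star T) : smap (fun=> u) x = st u.
Proof. exact: smap_cst. Qed.

Lemma smap_st T U {eT : encodable V T} {eU : encodable V U} (f : T -> U) (t : T) :
  smap f (st t) = st (f t).
Proof. by rewrite -(smap_const t (st t)) smap_comp smap_const. Qed.

Lemma Star_bool (b : Star bool) : b = st true \/ b = st false.
Proof.
pose proof (@xtransfer (Xall 0 (Xor (Xeq 0 2) (Xeq 0 3)))
  (env [:: univ bool; enc true; enc false])) as tr; move: tr.
rewrite /= => /(_ _ _ (StarP b))[|h|h].
- by move=> _ /mem_univ[[] _ <-]; [left|right].
- by left; apply: val_Star_inj.
- by right; apply: val_Star_inj.
Qed.

Lemma st_inj T {eT : encodable V T} : injective (@st T eT).
Proof.
move=> t u /(congr1 sval) /= e; apply: contrapT => tu.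
pose proof (@xtransfer (Xnot (Xeq 0 1)) (env [:: enc t; enc u])) as tr; move: tr.
by rewrite /=; apply=> // h; apply/tu/(enc_inj h).
Qed.

End Star.

Arguments Star {V} I T {eT}.
Arguments st {V I T eT} t.

(** * Transfer for standard predicates on star-extensions *)

Section Germs.
Variables (V : superstructure) (I : nonstandard_universe V).
Local Notation Star := (Star I).

Section Pairing.
Context {T U W : Type} {eT : encodable V T} {eU : encodable V U}
  {eW : encodable V W}.

Lemma spair_germ (f : T -> U) (g : T -> W) (x : Star T) :
  spair (smap f x) (smap g x) = smap (fun t => (f t, g t)) x.
Proof.
rewrite -(spairE (smap (fun t => (f t, g t)) x)) !smap_comp.
by congr spair; congr smap.
Qed.

Lemma spair_st (t : T) (u : U) : spair (st t : Star T) (st u) = st (t, u).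
Proof.
by rewrite -(smap_st I fst (t, u)) -(smap_st I snd (t, u)) spairE.
Qed.

Definition smap2 (f : T -> U -> W) (x : Star T) (y : Star U) : Star W :=
  smap (fun p => f p.1 p.2) (spair x y).

(** The extended characteristic function takes only the values [st true] and [st false] by
    [Star_bool], so that negation and conjunction commute with the extension. *)
Definition holds (P : T -> Prop) (x : Star T) : Prop :=
  smap (fun t => `[< P t >]) x = st true.

End Pairing.

Section Predicates.
Context {T U W : Type} {eT : encodable V T} {eU : encodable V U}
  {eW : encodable V W}.

Definition holds2 (R : T -> U -> Prop) (x : Star T) (y : Star U) : Prop :=
  holds (fun p => R p.1 p.2) (spair x y).

Definition holds3 (R : T -> U -> W -> Prop) (x : Star T) (y : Star U)
    (z : Star W) : Prop :=
  holds (fun p => R p.1.1 p.1.2 p.2) (spair (spair x y) z).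

Lemma holds_germ (P : U -> Prop) (f : T -> U) (x : Star T) :
  holds P (smap f x) = holds (fun t => P (f t)) x.
Proof. by rewrite /holds smap_comp. Qed.

Lemma holds_st (P : T -> Prop) (t : T) : holds P (st t) <-> P t.
Proof.
rewrite /holds smap_st; split=> [h|Pt]; first exact/asboolP/(st_inj h).
by congr st; apply/asboolP.
Qed.

Lemma holdsT (P : T -> Prop) (x : Star T) : (forall t, P t) -> holds P x.
Proof.
move=> hP; rewrite /holds -(smap_const true x); congr smap.
by apply/funext => t; apply/asboolP.
Qed.

Lemma st_trueNfalse : (st true : Star bool) <> st false.
Proof. by move=> h; have := st_inj h. Qed.

Lemma holds_not (P : T -> Prop) (x : Star T) :
  holds (fun t => ~ P t) x = (~ holds P x).
Proof.
rewrite /holds.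
rewrite (_ : (fun t => `[< ~ P t >]) = negb \o (fun t => `[< P t >])); last first.
  by apply/funext => t; rewrite /= asbool_neg.
rewrite -smap_comp.
case: (Star_bool (smap (fun t => `[< P t >]) x : Star bool)) => ->;
  rewrite smap_st /=.
  by rewrite propeqE; split=> [/esym/st_trueNfalse|[]].
by rewrite propeqE; split=> // _ /esym/st_trueNfalse.
Qed.

Lemma holds_and (P Q : T -> Prop) (x : Star T) :
  holds P x -> holds Q x -> holds (fun t => P t /\ Q t) x.
Proof.
rewrite /holds => hP hQ.
rewrite (_ : (fun t => `[< P t /\ Q t >]) =
  (fun p => p.1 && p.2) \o (fun t => (`[< P t >], `[< Q t >]))); last first.
  by apply/funext => t; rewrite /= asbool_and.
by rewrite -smap_comp -spair_germ hP hQ spair_st smap_st.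
Qed.

Lemma holds_imp (P Q : T -> Prop) (x : Star T) :
  (forall t, P t -> Q t) -> holds P x -> holds Q x.
Proof.
move=> PQ Px; apply: contrapT; rewrite -holds_not => nQ.
have : ~ holds (fun t => P t /\ ~ Q t) x.
  by rewrite -holds_not; apply: holdsT => t [/PQ].
by apply; exact: holds_and.
Qed.

Lemma holds_imp2 (P P' Q : T -> Prop) (x : Star T) :
  (forall t, P t -> P' t -> Q t) -> holds P x -> holds P' x -> holds Q x.
Proof.
by move=> PQ Px P'x; apply: holds_imp (holds_and Px P'x) => t []; exact: PQ.
Qed.

Lemma holds_imp3 (P P' P'' Q : T -> Prop) (x : Star T) :
  (forall t, P t -> P' t -> P'' t -> Q t) ->
  holds P x -> holds P' x -> holds P'' x -> holds Q x.
Proof.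
move=> PQ Px P'x; apply: holds_imp2 (holds_and Px P'x) => t []; exact: PQ.
Qed.

Lemma holds_imp4 (P P' P'' P3 Q : T -> Prop) (x : Star T) :
  (forall t, P t -> P' t -> P'' t -> P3 t -> Q t) ->
  holds P x -> holds P' x -> holds P'' x -> holds P3 x -> holds Q x.
Proof.
move=> PQ Px P'x; apply: holds_imp3 (holds_and Px P'x) => t []; exact: PQ.
Qed.

End Predicates.

Section EqualGerms.
Context {T U W : Type} {eT : encodable V T} {eU : encodable V U}
  {eW : encodable V W}.

Lemma smap_eq (f g : T -> U) (x : Star T) :
  (smap f x = smap g x) = holds (fun t => f t = g t) x.
Proof.
rewrite propeqE; split=> [e|].
  have : holds (fun p : U * U => p.1 = p.2) (spair (smap f x) (smap g x)).
    rewrite e spair_germ holds_germ; exact: holdsT.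
  by rewrite spair_germ holds_germ.
(* [f] is [if b then g else f], where [b] extends to [true] at [x] *)
rewrite /holds; set b := (fun t => `[< f t = g t >]) => bx.
pose k (p : T * bool) := if p.2 then g p.1 else f p.1.
have -> : f = k \o (fun t => (t, b t)).
  by apply/funext => t; rewrite /k /b /=; case: asboolP.
rewrite -smap_comp -spair_germ bx -(smap_const true x) spair_germ smap_comp.
by congr smap.
Qed.

Lemma smap2_germ S {eS : encodable V S} (F : U -> W -> S) (f : T -> U)
  (g : T -> W) (x : Star T) :
  smap2 F (smap f x) (smap g x) = smap (fun t => F (f t) (g t)) x.
Proof. by rewrite /smap2 spair_germ smap_comp. Qed.

Lemma holds2_germ (P : U -> W -> Prop) (f : T -> U) (g : T -> W) (x : Star T) :
  holds2 P (smap f x) (smap g x) = holds (fun t => P (f t) (g t)) x.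
Proof. by rewrite /holds2 spair_germ holds_germ. Qed.

Lemma holds3_germ S {eS : encodable V S} (P : U -> W -> S -> Prop) (f : T -> U)
  (g : T -> W) (h : T -> S) (x : Star T) :
  holds3 P (smap f x) (smap g x) (smap h x) =
  holds (fun t => P (f t) (g t) (h t)) x.
Proof. by rewrite /holds3 !spair_germ holds_germ. Qed.

Lemma st_germ (u : U) (x : Star T) : st u = smap (fun=> u) x.
Proof. by rewrite smap_const. Qed.

End EqualGerms.

Section Quantifiers.
Context {T U : Type} {eT : encodable V T} {eU : encodable V U}.

Lemma germ1 (x : Star T) : x = smap id x.
Proof. by rewrite smap_id. Qed.

(** Used throughout to write several points as images of a single [g] under standard maps. A
    relation between them then becomes one [holds] at [g], and implications between such relations
    are checked at standard points. *)
Lemma germ2 (x : Star T) (y : Star U) :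
  exists g : Star (T * U), x = smap fst g /\ y = smap snd g.
Proof. by exists (spair x y); rewrite smap_fst smap_snd. Qed.

Lemma germ3 W {eW : encodable V W} (x : Star T) (y : Star U) (z : Star W) :
  exists g : Star (T * U * W), [/\ x = smap (fun t => t.1.1) g,
    y = smap (fun t => t.1.2) g & z = smap snd g].
Proof.
exists (spair (spair x y) z); rewrite smap_snd; split=> //.
  by rewrite -[LHS](smap_fst x y) -[in LHS](smap_fst (spair x y) z) smap_comp.
by rewrite -[LHS](smap_snd x y) -[in LHS](smap_fst (spair x y) z) smap_comp.
Qed.

Lemma germ4 W S {eW : encodable V W} {eS : encodable V S} (x : Star T)
  (y : Star U) (z : Star W) (w : Star S) :
  exists g : Star (T * U * W * S), [/\ x = smap (fun t => t.1.1.1) g,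
    y = smap (fun t => t.1.1.2) g, z = smap (fun t => t.1.2) g
    & w = smap snd g].
Proof.
have [g [ex ey ez]] := germ3 x y z; exists (spair g w).
have e : g = smap fst (spair g w) by rewrite smap_fst.
by rewrite ex ey ez smap_snd; split=> //; rewrite [in LHS]e smap_comp.
Qed.

(** A Skolem function chosen among standard points extends, and its value at [x] is the witness. *)
Lemma holds_ex (P : T -> U -> Prop) (x : Star T) :
  holds (fun t => exists u, P t u) x -> exists y : Star U, holds2 P x y.
Proof.
move=> h; have [[u0]|nU] := pselect (exists u : U, True); last first.
  exfalso; move: h; rewrite -[holds _ x]notK -holds_not; apply.
  by apply: holdsT => t [u _]; apply: nU; exists u.
move=> _; have /choice[f hf] : forall t, exists u, (exists u, P t u) -> P t u.
  move=> t.
  by have [[u Pu]|n] := pselect (exists u, P t u); [exists u|exists u0].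
exists (smap f x); rewrite [X in holds2 _ X](germ1 x) holds2_germ.
exact: holds_imp h.
Qed.

Lemma holds_all (P : T -> U -> Prop) (x : Star T) :
  holds (fun t => forall u, P t u) x <-> forall y : Star U, holds2 P x y.
Proof.
split=> [h y|h].
  have [g [ex ey]] := germ2 x y; subst x y; move: h;
    rewrite holds2_germ holds_germ.
  exact: holds_imp.
apply: contrapT; rewrite -holds_not => h'.
have [|y] := @holds_ex (fun t u => ~ P t u) x.
  by apply: holds_imp h' => t /existsNP[u]; exists u.
have := h y; have [g [-> ->]] := germ2 x y; rewrite !holds2_germ.
by rewrite holds_not.
Qed.

Definition sin (x : Star T) (a : Star (set T)) : Prop :=
  holds2 (fun t (A : set T) => A t) x a.

Lemma sin_germ S {eS : encodable V S} (f : S -> T) (A : S -> set T) (x : Star S) :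
  sin (smap f x) (smap A x) = holds (fun s => A s (f s)) x.
Proof. exact: holds2_germ. Qed.

(** Transfer for the graph of the characteristic function [f] of membership; [sin] is defined
    through this function, while [imem] is the membership of the universe. *)
Lemma sinE (x : Star T) (a : Star (set T)) : imem (sval x) (sval a) <-> sin x a.
Proof.
pose f (p : T * set T) := `[< p.2 p.1 >].
have pxa := (spairP x a _).2 erefl.
have [q hq qf] : smap_rel f (sval (spair x a)) (sval (smap f (spair x a))).
  by apply: (smapP _ _ _).1.
pose proof (@xtransfer V I (Xall 0 (Xall 2 (Xall 4 (Xall 6 (Xall 8
  (Ximp (Xpair 2 4 3) (Ximp (Xpair 0 2 1)
     (Xand (Ximp (Xeq 1 10) (Xin 4 3)) (Ximp (Xin 4 3) (Xeq 1 10)))))))))) 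
  (env [:: univ T; univ (set T); univ (T * set T)%type; univ bool;
    graph_code f; enc true])) as tr.
rewrite /= in tr.
have [|h1 h2] := tr _ _ (StarP x) _ (StarP a) _ (StarP (spair x a)) _
  (StarP (smap f (spair x a))) _ qf pxa hq.
  move=> _ /mem_univ[t _ <-] _ /mem_univ[A _ <-] p1 _ b1 _ q1 q1f.
  move=> /(opairE p1 (enc t) (enc A)) p1E q1P.
  have {q1P} -> : b1 = enc (f (t, A)).
    by apply: mem_graph_code_pair q1f _; rewrite p1E in q1P.
  split=> [/(@enc_inj _ _ _ (f (t, A)) true)/asboolP|] At;
    first exact/mem_code_enc.
  by have /asboolP : A t by [exact/mem_code_enc]; rewrite /f /= => ->.
split=> [/h2 e|e]; last by apply: h1; exact: (congr1 sval e).
exact: val_Star_inj.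
Qed.

End Quantifiers.
End Germs.

(** * Internal sets as points of extended power sets *)

Section Internal.
Variables (V : superstructure) (I : nonstandard_universe V).
Local Notation Star := (Star I).

(** By extensionality the element with extension [S] is unique, hence it is [code S]. *)
Lemma star_setE (S : set V) (x : I) : bounded S ->
  star_set S x <-> imem x (star I (code S)).
Proof.
move=> /codeP[h1 h2]; split=> [[a [aA aS xa]]|h]; last by exists (code S).
suff <- : a = code S by [].
by apply: sext => // z; rewrite aS h2.
Qed.

Lemma bounded_atoms : bounded (range (@satom V)).
Proof. by exists 0. Qed.

Lemma is_isetE (x : I) : is_iset x <->
  ~ imem x (star I (code (range (@satom V)))).
Proof. by rewrite /is_iset (star_setE _ bounded_atoms). Qed.

Section Sets.
Context {T : Type} {eT : encodable V T}.

Lemma star_setP (P : set T) (x : I) :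
  star_set (enc @` P) x <-> exists y : Star T, x = sval y /\ holds P y.
Proof.
rewrite star_setE; last first.
  by apply: bounded_sub (@enc_bounded _ T _) => _ [t _ <-]; exists t.
have hP (y : Star T) : imem (sval y) (star I (code (enc @` P))) <-> holds P y.
  have -> : star I (code (enc @` P)) = sval (st P : Star (set T)) by [].
  rewrite sinE.
  by rewrite [y in sin y]germ1 (st_germ P y) sin_germ.
split=> [h|[y [-> /hP//]]].
suff xT : imem x (star I (@univ V T eT)).
  by exists (exist _ x xT); split=> //; apply/hP.
pose proof (@xtransfer V I (Xall 0 (Xin 0 2))
  (env [:: code (enc @` P); univ T])) as tr.
rewrite /= in tr; apply: tr h => _ /mem_code_img[t _ <-].
by apply/mem_univ; exists t.
Qed.

Lemma Star_set_sub (a : Star (set T)) (x : I) :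
  imem x (sval a) -> exists y : Star T, x = sval y.
Proof.
pose proof (@xtransfer V I (Xall 0 (Xall 0 (Xin 0 3)))
  (env [:: univ (set T); univ T])) as tr.
rewrite /= in tr => xa.
suff xT : imem x (star I (@univ V T eT)) by exists (exist _ x xT).
apply: tr xa; last exact: StarP.
move=> _ /mem_univ[A _ <-] _ /mem_code_img[t _ <-].
by apply/mem_univ; exists t.
Qed.

Lemma Star_set_iset (a : Star (set T)) : is_iset (sval a).
Proof.
apply/is_isetE.
pose proof (@xtransfer V I (Xall 0 (Xnot (Xin 0 2)))
  (env [:: univ (set T); code (range (@satom V))])) as tr.
rewrite /= in tr; apply: tr; last exact: StarP.
move=> _ /mem_univ[A _ <-] /(mem_code _ bounded_atoms).
have [|h _] := @codeP V (enc @` A); last exact: h.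
by apply: bounded_sub (@enc_bounded _ T _) => _ [t _ <-]; exists t.
Qed.

Lemma internal_Star (a : Star (set T)) : internal (sval @` [set x | sin x a]).
Proof.
exists (sval a); split; first exact: Star_set_iset.
apply/seteqP; split=> [_ [x xa <-]|x /= xa]; first exact/sinE.
have [y yx] := Star_set_sub xa; exists y => //.
by apply/sinE; rewrite -yx.
Qed.

(** Transfer of separation. The internal set may have members outside the extension of [T], so only
    its trace becomes a point of the extended power set. *)
Lemma internal_trace (A : set I) : internal A ->
  exists a : Star (set T), forall x : Star T, sin x a <-> A (sval x).
Proof.
move=> [a [_ ->]]; have [b ab] := internal_bounded a.
pose proof (@xtransfer V I (Xall 0 (Xex 3 (Xall 3 (Xand
  (Ximp (Xin 0 1) (Xin 0 2)) (Ximp (Xin 0 2) (Xin 0 1))))))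
  (env [:: b; univ T; univ (set T)])) as tr.
rewrite /= in tr; have [|a' [a'P h]] := tr _ _ ab.
  move=> y yb; exists (enc [set t : T | smem (enc t) y]); split.
    by apply/mem_univ; exists [set t : T | smem (enc t) y].
  by move=> _ /mem_univ[t _ <-]; split=> [/mem_code_enc|ty];
    last exact/mem_code_enc.
exists (exist _ a' a'P) => x; rewrite -sinE /=.
by have [] := h _ (StarP x).
Qed.

Lemma Star_setP (a : I) : is_iset a ->
  (forall x, imem x a -> exists y : Star T, x = sval y) ->
  exists b : Star (set T), a = sval b.
Proof.
move=> /is_isetE ai aT; have [b ab] := internal_bounded a.
suff aS : imem a (star I (@univ V (set T) (encodable_set eT))) by exists (exist
  _ a aS).
pose proof (@xtransfer V I (Xall 0 (Ximp (Xnot (Xin 0 4))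
  (Ximp (Xall 0 (Xin 0 3)) (Xin 0 3))))
  (env [:: b; univ T; univ (set T); code (range (@satom V))])) as tr.
rewrite /= in tr; apply: tr ab ai _; last first.
  by move=> x /aT[y ->]; exact: StarP.
move=> y yb yA yT; apply/mem_univ; exists [set t : T | smem (enc t) y] => //.
apply: sext.
- have [|h _] := @codeP V (enc @` [set t : T | smem (enc t) y]); last exact: h.
  by apply: bounded_sub (@enc_bounded _ T _) => _ [t _ <-]; exists t.
- by move=> yr; apply: yA; apply/(mem_code _ bounded_atoms).
- move=> z; split=> [/mem_code_img[t ty <-]//|zy].
  have /mem_univ[t _ tz] := yT _ zy; rewrite -tz in zy *.
  exact/mem_code_enc.
Qed.

Hypothesis sat : countably_saturated I.

Lemma saturation (a : nat -> Star (set T)) :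
  (forall n, exists x, forall i, (i <= n)%N -> sin x (a i)) ->
  exists x, forall i, sin x (a i).
Proof.
move=> h; have [i|n|x xa] := @sat (fun n => sval @` [set x | sin x (a n)]).
- exact: internal_Star.
- by have [x xa] := h n; exists (sval x) => i /= /xa; exists x.
- have [y _ yx] := xa 0 Logic.I; exists y => i.
  by have [z zi zx] := xa i Logic.I; rewrite (val_Star_inj (etrans yx (esym zx))).
Qed.

End Sets.
End Internal.

(** * Countably determined sets and injections *)

Section Determined.
Variables (V : superstructure) (I : nonstandard_universe V).
Local Notation Star := (Star I).

(** A form of countable determinacy without the tree of sets, equivalent to it by [CD_determined]
    and [determined_CD]; it makes closure under countable Boolean operations immediate. *)
Definition determined T {eT : encodable V T} (A : set (Star T)) : Prop :=
  exists a : nat -> Star (set T),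
    forall x y, (forall n, sin x (a n) <-> sin y (a n)) -> A x -> A y.

Section Closure.
Context {T U W : Type} {eT : encodable V T} {eU : encodable V U}
  {eW : encodable V W}.

(** The sequences that determine the sets [B k] are merged along [pickle]; an index that codes
    nothing carries the empty set. *)
Lemma determined_countable (K : countType) (B : K -> set (Star T))
    (A : set (Star T)) :
  (forall k, determined (B k)) ->
  (forall x y, (forall k, B k x <-> B k y) -> A x -> A y) -> determined A.
Proof.
move=> /choice[a ha] hA.
exists (fun n => if unpickle n is Some p then a p.1 p.2 else st set0).
move=> x y xy; apply: hA => k.
have e n : sin x (a k n) <-> sin y (a k n).
  by have := xy (pickle (k, n)); rewrite pickleK.
by split; apply: ha => n; rewrite e.
Qed.

Lemma determined_sin (a : Star (set T)) : determined [set x | sin x a].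
Proof. by exists (fun=> a) => x y /(_ 0)/= <-. Qed.

Lemma determined_holds2 (P : T -> U -> Prop) (u : Star U) :
  determined [set x | holds2 P x u].
Proof.
rewrite (_ : [set x | _] = [set x | sin x (smap (fun u => [set t | P t u]) u)]).
  exact: determined_sin.
apply/funext => x /=; have [g [-> ->]] := germ2 x u.
by rewrite holds2_germ smap_comp sin_germ.
Qed.

Lemma determined_preimage2 (f : T -> U -> W) (u : Star U) (A : set (Star W)) :
  determined A -> determined [set x | A (smap2 f x u)].
Proof.
move=> [a ha]; exists (fun n => smap2 (fun u S => [set t | S (f t u)]) u (a n)).
move=> x y xy; apply: ha => n; have := xy n.
enough (h : forall z : Star T, sin z (smap2 (fun u S =>
  [set t | S (f t u)]) u (a n)) =
    sin (smap2 f z u) (a n)) by (rewrite !h //).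
move=> z; have [g [-> -> ->]] := germ3 z u (a n).
by rewrite !smap2_germ !sin_germ.
Qed.

Lemma determined_preimage (f : T -> W) (A : set (Star W)) :
  determined A -> determined [set x | A (smap f x)].
Proof.
move=> [a ha]; exists (fun n => smap (fun S => [set t | S (f t)]) (a n)).
move=> x y xy; apply: ha => n; have := xy n.
enough (h : forall z : Star T, sin z (smap (fun S => [set t | S (f t)]) (a n)) =
    sin (smap f z) (a n)) by (rewrite !h //).
move=> z; have [g [-> ->]] := germ2 z (a n).
by rewrite !smap_comp !sin_germ.
Qed.

Lemma determined_and (A B : set (Star T)) : determined A -> determined B ->
  determined [set x | A x /\ B x].
Proof.
move=> hA hB; apply: (@determined_countable bool (fun b => if b then A else B)).
  by case.
by move=> x y xy [Ax Bx]; split; [apply/(xy true)|apply/(xy false)].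
Qed.

Fixpoint atom (a : nat -> Star (set T)) (f : nat -> bool) (k : nat) :
    Star (set T) :=
  if k is j.+1 then
    smap2 (fun (A B : set T) => [set t | A t /\ (B t <-> f j)]) (atom a f j) (a j)
  else st setT.

Lemma atomP a f k x :
  sin x (atom a f k) <-> forall i, (i < k)%N -> sin x (a i) <-> f i.
Proof.
elim: k => [|k IH] /=.
  split=> // _; rewrite [x]germ1 (st_germ _ x) sin_germ; exact: holdsT.
have -> : sin x (smap2 (fun A B : set T => [set t | A t /\ (B t <-> f k)])
    (atom a f k) (a k)) <-> sin x (atom a f k) /\ (sin x (a k) <-> f k).
  have [g [-> -> ->]] := germ3 x (atom a f k) (a k).
  rewrite smap2_germ !sin_germ; split=> [h|[h1 h2]].
    split; first by apply: holds_imp h => t [].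
    case fk : (f k) h => h; split=> //.
      by move=> _; apply: holds_imp h => t [_ ->].
    move=> h2; suff : holds (fun=> False) g.
      by have := @holdsT _ I _ _ (fun=> ~ False) g (fun=> id); rewrite holds_not.
    by apply: holds_imp2 h h2 => t [_ ->].
  have [fk|/negP fk] := boolP (f k).
    by apply: holds_imp2 h1 (h2.2 fk) => t At Bt; split=> //; split.
  have : ~ holds (fun t => smap snd g = smap snd g /\ (snd t) (t.1.1)) g.
    by move=> h; apply/fk/h2; apply: holds_imp h => t [].
  rewrite -holds_not => h3.
  by apply: holds_imp2 h1 h3 => t At Bt; split=> //; split=> // h; case: Bt.
rewrite IH; split=> [[h1 h2] i|h].
  by rewrite ltnS leq_eqVlt => /orP[/eqP->//|/h1].
by split; [move=> i ik; apply: h; exact: ltnW|exact: h].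
Qed.

End Closure.

Section Projection.
Hypothesis sat : countably_saturated I.
Context {T U : Type} {eT : encodable V T} {eU : encodable V U}.

(** The projections [B s] of the finite cells are determined and countable in number. If [x'] lies
    in the same ones as [x], every finite part of the trace of the pair of [x] and [y] is realised
    over [x'], and saturation yields one [y'] realising the whole trace. *)
Lemma determined_proj (A : set (Star (T * U))) : determined A ->
  determined [set x | exists y, A (spair x y)].
Proof.
move=> [a ha]; pose B (s : seq bool) := [set x : Star T | exists y,
  sin (spair x y) (atom a (nth false s) (size s))].
apply: (@determined_countable _ _ (seq bool) B) => [s|x x' xx' [y Axy]].
  pose b := atom a (nth false s) (size s).
  rewrite (_ : B s = [set x | holds2 (fun t (S : set (T * U)) =>
     exists u, S (t, u)) x b]); first exact: determined_holds2.
  apply/seteqP; split=> [x [y]|x /= ].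
    rewrite -/b /=; have [g [-> -> ->]] := germ3 x y b.
    by rewrite spair_germ sin_germ holds2_germ; apply: holds_imp => t h;
      eexists; exact: h.
  have [g [ex eb]] := germ2 x b.
  rewrite ex eb holds2_germ => /holds_ex[y h]; exists y; rewrite -/b eb.
  move: h; have [g' [-> ->]] := germ2 g y.
  by rewrite holds2_germ !smap_comp spair_germ sin_germ.
pose f n := `[< sin (spair x y) (a n) >].
pose (c k := smap2 (fun (S : set (T * U)) t => [set u | S (t, u)])
  (atom a f k) x').
assert (cE : forall k z, sin z (c k) = sin (spair x' z) (atom a f k)).
  move=> k z; rewrite /c; have [g [-> -> ->]] := germ3 z x' (atom a f k).
  by rewrite smap2_germ spair_germ !sin_germ.
have [|y' hy'] := @saturation V I _ _ sat c.
  move=> n; have /xx'[y'] : B (mkseq f n) x.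
    exists y; apply/atomP => i; rewrite size_mkseq => ni.
    by rewrite nth_mkseq //; split=> [?|/asboolP//]; exact/asboolP.
  rewrite size_mkseq => /atomP h; exists y' => i ni.
  rewrite cE; apply/atomP => j ji.
  have jn : (j < n)%N by exact: leq_trans ni.
  by rewrite h // nth_mkseq.
exists y'; apply: ha Axy => n; have := hy' n.+1.
rewrite cE => /atomP ->//.
by split=> [?|/asboolP//]; exact/asboolP.
Qed.

End Projection.

Definition determined2 T U {eT : encodable V T} {eU : encodable V U}
    (R : Star T -> Star U -> Prop) :=
  determined [set p | R (smap fst p) (smap snd p)].

(** A countably determined injection is given by its graph, so that no values outside [A] have to be
    chosen. *)
Definition sle T U {eT : encodable V T} {eU : encodable V U}
    (A : set (Star T)) (B : set (Star U)) : Prop :=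
  exists R : Star T -> Star U -> Prop,
  [/\ determined2 R, forall x y, R x y -> A x /\ B y,
      forall x, A x -> exists y, R x y,
      forall x y y', R x y -> R x y' -> y = y'
    & forall x x' y, R x y -> R x' y -> x = x'].

Section Injections.
Context {T U W : Type} {eT : encodable V T} {eU : encodable V U}
  {eW : encodable V W}.

Lemma determined2_sym (R : Star T -> Star U -> Prop) : determined2 R ->
  determined2 (fun y x => R x y).
Proof.
move=> /(determined_preimage (fun p : U * T => (p.2, p.1))).
by congr determined; apply/funext => p /=; rewrite !smap_comp.
Qed.

Lemma determined2_fun S {eS : encodable V S} (f : T -> S -> U) (s : Star S) :
  determined2 (fun x y => y = smap2 f x s).
Proof.
rewrite /determined2 (_ : [set p | _] =
  [set p | holds2 (fun (p : T * U) s => p.2 = f p.1 s) p s]).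
  exact: determined_holds2.
apply/funext => p /=; have [g [-> ->]] := germ2 p s.
by rewrite !smap_comp smap2_germ smap_eq holds2_germ.
Qed.

(** Whether a pair lies on the glued graph depends only on the countably many pieces and the
    countably many graphs of the [f k]. *)
Lemma sle_piecewise (K : countType) (A : set (Star T)) (B : set (Star U))
    (i : Star T -> K) (f : K -> Star T -> Star U) :
  (forall k, determined [set x | A x /\ i x = k]) ->
  (forall k, determined2 (fun x y => y = f k x)) ->
  (forall x, A x -> B (f (i x) x)) ->
  (forall x x', A x -> A x' -> f (i x) x = f (i x') x' -> x = x') ->
  sle A B.
Proof.
move=> hi hf AB finj; exists (fun x y => A x /\ y = f (i x) x); split.
- pose (C := fun k : K + K => match k with
    | inl k => [set p : Star (T * U) | A (smap fst p) /\ i (smap fst p) = k]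
    | inr k => [set p : Star (T * U) | smap snd p = f k (smap fst p)] end).
  rewrite /determined2; apply: (@determined_countable _ _ (K + K)%type C) =>
    [[k|k]|p q pq [Ap ep]] /=.
  + exact: (determined_preimage fst (hi k)).
  + exact: hf.
  have [Aq iq] : A (smap fst q) /\ i (smap fst q) = i (smap fst p).
    by have := (pq (inl (i (smap fst p)))).1; apply.
  by split=> //; rewrite iq; have := (pq (inr (i (smap fst p)))).1; apply.
- by move=> x y [Ax ->]; split=> //; exact: AB.
- by move=> x Ax; exists (f (i x) x).
- by move=> x y y' [_ ->] [_ ->].
- by move=> x x' y [Ax ->] [Ax']; exact: finj.
Qed.

Hypothesis sat : countably_saturated I.

Lemma determined_range (R : Star T -> Star U -> Prop) : determined2 R ->
  determined [set y | exists x, R x y].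
Proof.
move=> /determined2_sym/(determined_proj sat); congr determined.
apply/funext => y /=; apply/propext.
by split=> -[x]; [|exists x]; rewrite ?smap_fst ?smap_snd //; exists x.
Qed.

End Injections.

(** The composite graph is a projection along the middle point; saturation enters through
    [determined_proj]. *)
Lemma sle_trans (sat : countably_saturated I) T U W {eT : encodable V T}
  {eU : encodable V U} {eW : encodable V W} (A : set (Star T))
  (B : set (Star U)) (C : set (Star W)) : sle A B -> sle B C -> sle A C.
Proof.
move=> [R [R1 R2 R3 R4 R5]] [S [S1 S2 S3 S4 S5]].
exists (fun x z => exists2 y, R x y & S y z); split.
- pose proof (determined_preimage (fun p : T * W * U => (p.1.1, p.2)) R1) as h1.
  pose proof (determined_preimage (fun p : T * W * U => (p.2, p.1.2)) S1) as h2.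
  have := determined_proj sat (determined_and h1 h2).
  congr determined; apply/funext => p; apply/propext.
  assert (h : forall y : Star U, (R (smap fst p) y /\ S y (smap snd p)) =
    (R (smap fst (smap (fun q : T * W * U => (q.1.1, q.2)) (spair p y)))
      (smap snd (smap (fun q : T * W * U => (q.1.1, q.2)) (spair p y))) /\
    S (smap fst (smap (fun q : T * W * U => (q.2, q.1.2)) (spair p y)))
      (smap snd (smap (fun q : T * W * U => (q.2, q.1.2)) (spair p y))))).
    move=> y; rewrite !smap_comp /comp /=; move: (germ2 p y) => [g [-> ->]].
    by rewrite spair_germ !smap_comp.
  split=> [[y]|[y Rp Sp]]; last by exists y; rewrite /= -h.
  by rewrite /= -h => -[Rp Sp]; exists y.
- by move=> x z [y /R2[Ax _] /S2[_ Cz]].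
- move=> x /R3[y Rxy]; have [_ /S3[z Syz]] := R2 _ _ Rxy.
  by exists z, y.
- move=> x z z' [y xy yz] [y' xy' yz'].
  by move: yz'; rewrite -(R4 _ _ _ xy xy'); exact: S4.
- move=> x x' z [y xy yz] [y' xy' yz'].
  by move: xy'; rewrite -(S5 _ _ _ yz yz'); exact: R5.
Qed.

End Determined.

(** * Translation between the set-theoretic notions and the typed ones *)

Section Bridge.
Variables (V : superstructure) (I : nonstandard_universe V).
Local Notation Star := (Star I).

Lemma val_image T {eT : encodable V T} (A : set (Star T)) x :
  (sval @` A) (sval x) <-> A x.
Proof. by split=> [[y Ay /val_Star_inj<-]|Ax]; last exists x. Qed.

Section CD.
Context {T : Type} {eT : encodable V T}.

(** There are only countably many finite binary sequences [s], and membership depends only on which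
    of the [X_ s] contain the point. *)
Lemma CD_determined (A : set (Star T)) : CD (sval @` A) -> determined A.
Proof.
move=> [F [X_ [iX _ AE]]].
have /choice[b hb] : forall s, exists b : Star (set T), forall x,
  sin x b <-> X_ s (sval x) by move=> s; exact: internal_trace.
apply: (@determined_countable _ _ _ _ (seq bool) (fun s =>
  [set x | sin x (b s)])).
  by move=> s; exact: determined_sin.
move=> x y xy /val_image; rewrite AE => -[f Ff fx].
apply/val_image; rewrite AE; exists f => // m _.
by apply/hb/(xy (mkseq f m))/hb; exact: fx.
Qed.

(** The tree consists of the finite cells [atom], and [F] of the infinite traces realised by points
    of [A]. *)
Lemma determined_CD (A : set (Star T)) : determined A -> CD (sval @` A).
Proof.
move=> [a ha]; pose X_ (s : seq bool) :=
  sval @` [set x : Star T | sin x (atom a (nth false s) (size s))].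
exists [set f | exists2 x, A x & forall n, sin x (a n) <-> f n], X_; split.
- by move=> s; exact: internal_Star.
- move=> s t st _ [x /atomP h <-]; exists x => //; apply/atomP => i si.
  have st' : (size s <= size t)%N by exact: size_prefix.
  rewrite h ?(leq_trans si) //; move: st => /prefixP[r ->].
  by rewrite nth_cat si.
apply/seteqP; split=> [_ [x Ax <-]|z [f [x Ax fx] fz]].
  exists (fun n => `[< sin x (a n) >]).
    by exists x => // n; split=> [?|/asboolP//]; exact/asboolP.
  move=> m _; exists x => //; apply/atomP => i; rewrite size_mkseq => im.
  by rewrite nth_mkseq //; split=> [?|/asboolP//]; exact/asboolP.
have [y _ yz] := fz 0 Logic.I; exists y => //.
apply: ha Ax => n; rewrite fx.
have [y' /atomP h y'z] := fz n.+1 Logic.I.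
rewrite (val_Star_inj (etrans yz (esym y'z))) h ?size_mkseq //.
by rewrite nth_mkseq.
Qed.

End CD.

Section Le.
Context {T U : Type} {eT : encodable V T} {eU : encodable V U}.

Lemma graph_onE (A : set (Star T)) (f : I -> I) (R : Star T -> Star U -> Prop) :
  (forall x y, R x y <-> A x /\ sval y = f (sval x)) ->
  (forall x, A x -> exists y : Star U, sval y = f (sval x)) ->
  graph_on (sval @` A) f =
    sval @` [set p : Star (T * U) | R (smap fst p) (smap snd p)].
Proof.
move=> hR hA; apply/seteqP; split=> [p [_ [x Ax <-]]|_ [p /hR[Ap ep] <-]].
  have [y yx] := hA x Ax; rewrite -yx => /spairP ->.
  by exists (spair x y) => //=; apply/hR; rewrite smap_fst smap_snd.
exists (sval (smap fst p)); first by exists (smap fst p).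
by rewrite -ep; apply/spairP; rewrite spairE.
Qed.

Lemma CD_le_sle (A : set (Star T)) (B : set (Star U)) :
  CD_le (sval @` A) (sval @` B) -> sle A B.
Proof.
move=> [f [fAB fI]]; pose (R :=
  fun (x : Star T) (y : Star U) => A x /\ sval y = f (sval x)).
have AB x : A x -> exists y : Star U, B y /\ sval y = f (sval x).
  by move=> Ax; have [|y By yx] := fAB (sval x); [exists x|exists y].
rewrite (@graph_onE A f R) // => [/CD_determined gR|x /AB[y []]];
  last by exists y.
exists R; split=> //.
- move=> x y [Ax yx]; split=> //; have [y' [By' y'x]] := AB x Ax.
  by rewrite (val_Star_inj (etrans yx (esym y'x))).
- by move=> x Ax; have [y [_ yx]] := AB x Ax; exists y.
- by move=> x y y' [_ yx] [_ y'x]; apply: val_Star_inj; rewrite yx.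
- move=> x x' y [Ax yx] [Ax' yx']; apply: val_Star_inj; apply: fI.
  + by rewrite inE; exists x.
  + by rewrite inE; exists x'.
  + by rewrite -yx.
Qed.

Lemma sle_CD_le (A : set (Star T)) (B : set (Star U)) :
  sle A B -> CD_le (sval @` A) (sval @` B).
Proof.
move=> [R [R1 R2 R3 R4 R5]].
have /choice[f hf] : forall z : I, exists w : I, forall (x : Star T) (y : Star U),
    sval x = z -> R x y -> w = sval y.
  move=> z; have [[x [y [xz Rxy]]]|n] :=
    pselect (exists x y, sval x = z /\ R x y).
    exists (sval y) => x' y' x'z; rewrite (val_Star_inj (etrans x'z (esym xz))).
    by move=> /(R4 _ _ _ Rxy)->.
  (* Outside the domain of [R] the function is taken to be the identity. *)
  by exists z => x y xz Rxy; case: n; exists x, y.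
have {}hf x y : R x y -> sval y = f (sval x) by move=> /hf->.
exists f; split.
- move=> _ [x /R3[y Rxy] <-]; rewrite -(hf _ _ Rxy); exists y => //.
  by have [] := R2 _ _ Rxy.
- move=> z z'; rewrite !inE => -[x Ax <-] [x' Ax' <-] e.
  have [[y xy] [y' xy']] := (R3 _ Ax, R3 _ Ax').
  congr sval; apply: (R5 _ _ y) => //.
  suff -> : y = y' by [].
  by apply: val_Star_inj; rewrite (hf _ _ xy) (hf _ _ xy').
- rewrite (@graph_onE A f R); first exact: determined_CD.
  + move=> x y; split=> [Rxy|[/R3[y' Rxy'] yx]].
      by split; [have [] := R2 _ _ Rxy|exact: hf].
    suff -> : y = y' by [].
    by apply: val_Star_inj; rewrite (hf _ _ Rxy').
  + by move=> x /R3[y /hf]; exists y.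
Qed.

End Le.

Section Numbers.

Lemma star_relE (R : nat -> nat -> Prop) (x y : I) :
  star_rel R x y <->
  exists a b : Star nat, [/\ x = sval a, y = sval b & holds2 R a b].
Proof.
rewrite /star_rel (_ : [set q | _] =
  enc @` [set p : nat * nat | R p.1 p.2]); last first.
  apply/seteqP; split=> [q [m [n [Rmn /opairE ->]]]|_ [[m n] /= Rmn <-]].
    by exists (m, n).
  by exists m, n; split=> //; exact: opair_kpair.
split=> [[p pxy /star_setP[q [pq hq]]]|[a [b [-> -> Rab]]]].
  exists (smap fst q), (smap snd q); rewrite /holds2 spairE.
  pose proof ((spairP (smap fst q) (smap snd q) _).2 erefl) as qP.
  rewrite spairE -pq in qP.
  by have [-> ->] := opair_inj pxy qP.
exists (sval (spair a b)); first exact/spairP.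
by apply/star_setP; exists (spair a b).
Qed.

Lemma star_funE (f : nat -> nat) (x y : I) :
  star_fun f x y <-> exists a : Star nat, x = sval a /\ y = sval (smap f a).
Proof.
rewrite /star_fun star_relE; split=> [[a [b [-> -> h]]]|[a [-> ->]]]; exists a.
  split=> //; congr sval; move: h; have [g [-> ->]] := germ2 a b.
  by rewrite holds2_germ smap_comp smap_eq.
exists (smap f a); split=> //; rewrite [X in holds2 _ X]germ1 holds2_germ.
exact: holdsT.
Qed.

End Numbers.

End Bridge.

(** * Binary digits and sorting *)

Local Open Scope nat_scope.

(* The most significant of the [d] digits comes first. *)
Definition bit (d x i : nat) : bool := odd (x %/ 2 ^ (d - i.+1)).

Fixpoint num (d : nat) (f : nat -> bool) : nat :=
  if d is e.+1 then (num e f).*2 + f e else 0.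

Lemma num_lt d f : num d f < 2 ^ d.
Proof.
elim: d => //= d IH; rewrite expnS.
by case: (f d); rewrite ?addn1 ?addn0; lia.
Qed.

Lemma eq_num d f g : (forall i, i < d -> f i = g i) -> num d f = num d g.
Proof.
elim: d => //= d IH fg; rewrite fg // IH // => i id.
by apply: fg; rewrite ltnS ltnW.
Qed.

Lemma bit_half d x i : i < d -> bit d.+1 x i = bit d x./2 i.
Proof. by move=> id; rewrite /bit subSS -divn2 -divnMA -expnS;
  congr (odd (x %/ 2 ^ _)); lia. Qed.

Lemma num_half d f : (num d.+1 f)./2 = num d f.
Proof. by rewrite /=; case: (f d) => /=; lia. Qed.

Lemma bit_num d f i : i < d -> bit d (num d f) i = f i.
Proof.
elim: d => // d IH; rewrite ltnS leq_eqVlt => /orP[/eqP->|id].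
  by rewrite /bit subnn divn1 /= oddD odd_double; case: (f d).
by rewrite bit_half // num_half IH.
Qed.

Lemma num_bit d x : x < 2 ^ d -> num d (bit d x) = x.
Proof.
elim: d x => [|d IH] x /=; first by case: x.
rewrite expnS => xd; rewrite (@eq_num _ _ (bit d x./2)); last by move=> i;
  exact: bit_half.
rewrite IH; last by lia.
by rewrite /bit subnn divn1 addnC odd_double_half.
Qed.

Lemma bit_div d k x i : i < k -> k <= d -> bit k (x %/ 2 ^ (d - k)) i = bit d x i.
Proof.
by move=> ik kd; rewrite /bit -divnMA -expnD; congr (odd (x %/ 2 ^ _)); lia.
Qed.

Lemma eq_bit_div d k x y : k <= d -> x < 2 ^ d -> y < 2 ^ d ->
  (forall i, i < k -> bit d x i = bit d y i) ->
  x %/ 2 ^ (d - k) = y %/ 2 ^ (d - k).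
Proof.
move=> kd xd yd xy.
have lt z : z < 2 ^ d -> z %/ 2 ^ (d - k) < 2 ^ k.
  by move=> zd; rewrite ltn_divLR ?expn_gt0// -expnD subnKC.
rewrite -(num_bit (lt x xd)) -(num_bit (lt y yd)); apply: eq_num => i ik.
by rewrite !bit_div // xy.
Qed.

Definition dist x y := (x - y) + (y - x).

(** Equal quotients put both numbers into one block of length [2 ^ (d - k)], and [2 ^ d] consists of
    [2 ^ k], hence at least [n.+1], such blocks. *)
Lemma eq_div_dist d k n x y : k <= d -> n < 2 ^ k ->
  x %/ 2 ^ (d - k) = y %/ 2 ^ (d - k) -> dist x y <= 2 ^ d %/ n.+1.
Proof.
move=> kd nk xy; set m := 2 ^ (d - k) in xy *.
have m0 : 0 < m by rewrite expn_gt0.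
have -> : 2 ^ d = m * 2 ^ k by rewrite -expnD subnK.
apply: (@leq_trans m); last by rewrite leq_divRL // leq_mul2l nk orbT.
have := divn_eq x m; have := divn_eq y m; rewrite xy.
by have := ltn_pmod x m0; have := ltn_pmod y m0; rewrite /dist; lia.
Qed.

(** Codes the signed difference of [x] and [e] by a natural number: nonnegative differences get even
    codes, negative ones odd codes. *)
Definition zigzag x e := if e <= x then (x - e).*2 else (e - x).*2.+1.

Lemma zigzag_inj e : injective (zigzag ^~ e).
Proof. by move=> x y /=; rewrite /zigzag; case: (leqP e x) => ?;
  case: (leqP e y) => ?; lia. Qed.

Lemma zigzag_le x e : zigzag x e <= (dist x e).*2.+1.
Proof. by rewrite /zigzag /dist; case: (leqP e x) => ?; lia. Qed.

(** Uniqueness of the power of two and the odd part; it serves as a pairing function whose values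
    stay proportional to [x] for fixed [i]. *)
Lemma pow2_odd_inj i j x y : 2 ^ i * x.*2.+1 = 2 ^ j * y.*2.+1 -> i = j /\ x = y.
Proof.
elim: i j => [|i IH] [|j]; rewrite ?expnS ?expn0; try lia.
by move=> h; have [|-> ->] := IH j; lia.
Qed.

(** With [z] the distance, the left side is at most [2 ^ i * (4 * z + 3)]. After multiplication by
    [n.+1], the constants 8 and 6 bound each of its two terms by half of [D]. *)
Lemma pow2_zigzag_le D i n x e :
  dist x e <= D %/ (2 ^ i * 8 * n.+1).-1.+1 -> 2 ^ i * 6 * n.+1 <= D ->
  2 ^ i * (zigzag x e).*2.+1 <= D %/ n.+1.
Proof.
have p0 : 0 < 2 ^ i by rewrite expn_gt0.
rewrite prednK ?muln_gt0 ?p0 // leq_divRL ?muln_gt0 ?p0 // leq_divRL // => h1 h2.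
have h3 := zigzag_le x e.
apply: (@leq_trans (2 ^ i * ((dist x e).*2.+1).*2.+1 * n.+1)).
  by rewrite leq_mul2r leq_mul2l; apply/orP; right; apply/orP; right; lia.
by move: h1 h2; move: (dist x e) (2 ^ i) p0 => z p _; lia.
Qed.

Lemma monotone_cut N (f : nat -> nat) v :
  (forall x y, x <= y -> y < N -> f x <= f y) ->
  exists e, forall x, x < N -> (x < e) = (f x < v).
Proof.
elim: N => [|N IH] mono; first by exists 0.
have [fv|fv] := ltnP (f N) v.
  exists N.+1 => x xN; rewrite xN; apply/esym/leq_ltn_trans/fv.
  exact: mono.
have [|e he] := IH; first by move=> x y xy yN; apply: mono => //; exact: ltnW.
exists (minn e N) => x; rewrite ltnS leq_eqVlt => /orP[/eqP->|xN].
  by rewrite leq_min ltnn andbF; apply/esym/negbTE; rewrite -leqNgt.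
by rewrite leq_min xN andbT he.
Qed.

Lemma sorting N (f : nat -> nat) :
  exists s : nat -> nat, [/\ forall i, i < N -> s i < N,
    forall i j, i < N -> j < N -> s i = s j -> i = j,
    forall x, x < N -> exists2 i, i < N & s i = x
  & forall i j, i <= j -> j < N -> f (s i) <= f (s j)].
Proof.
pose l := sort (relpre f leq) (iota 0 N).
have pl : perm_eq l (iota 0 N) by rewrite perm_sort.
have sl : size l = N by rewrite (perm_size pl) size_iota.
have ul : uniq l by rewrite (perm_uniq pl) iota_uniq.
have ml x : (x \in l) = (x < N) by rewrite (perm_mem pl) mem_iota add0n.
exists (nth 0 l); split.
- by move=> i iN; rewrite -ml mem_nth ?sl.
- by move=> i j iN jN /eqP; rewrite nth_uniq ?sl // => /eqP.
- move=> x; rewrite -ml => xl; exists (index x l); last by rewrite nth_index.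
  by rewrite -sl index_mem.
- move=> i j ij jN; have sorted_l : sorted (relpre f leq) l.
    by apply: sort_sorted => x y; exact: leq_total.
  apply: (sorted_leq_nth _ _ 0 sorted_l) => //=.
  + by move=> y x z; exact: leq_trans.
  + by move=> x; exact: leqnn.
  + by rewrite inE sl (leq_ltn_trans ij).
  + by rewrite inE sl.
Qed.

(** * Halos *)

Section Hypernaturals.
Variables (V : superstructure) (I : nonstandard_universe V).
Local Notation Star := (Star I).

Lemma holds_eq_st T {eT : encodable V T} (u : T) (x : Star T) :
  holds (fun t => t = u) x = (x = st u).
Proof. by rewrite [in RHS](germ1 x) (st_germ u x) smap_eq. Qed.

Lemma holds_false T {eT : encodable V T} (x : Star T) : ~ holds (fun=> False) x.
Proof. by rewrite -holds_not; apply: holdsT => t []. Qed.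

Lemma lt_st n (x : Star nat) : holds (fun t => t < n) x ->
  exists2 k, k < n & x = st k.
Proof.
elim: n => [|n IH] h.
  by case: (@holds_false _ _ x); apply: holds_imp h.
have [/IH[k kn ->]|] := pselect (holds (fun t => t < n) x).
  by exists k => //; exact: ltnW.
rewrite -holds_not => h'; exists n => //; rewrite -holds_eq_st.
by apply: holds_imp2 h h' => t; lia.
Qed.

Lemma holds_nat_all T {eT : encodable V T} (P : nat -> T -> Prop) k (x : Star T) :
  (forall i, i < k -> holds (P i) x) ->
  holds (fun t => forall i, i < k -> P i t) x.
Proof.
elim: k => [|k IH] h; first exact: holdsT.
have hk := h k (ltnSn k); have {}h := IH (fun i ik => h i (ltnW ik)).
apply: holds_imp2 h hk => t h1 h2 i; rewrite ltnS leq_eqVlt.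
by move=> /orP[/eqP->//|]; exact: h1.
Qed.

Lemma sle_subr T {eT : encodable V T} U {eU : encodable V U}
  (A : set (Star U)) (B C : set (Star T)) :
  B `<=` C -> sle A B -> sle A C.
Proof.
move=> BC [R [R1 R2 R3 R4 R5]]; exists R; split=> //.
by move=> x y /R2[Ax /BC].
Qed.

Lemma sle_sub T {eT : encodable V T} (A B : set (Star T)) :
  determined A -> A `<=` B -> sle A B.
Proof.
move=> hA AB; exists (fun x y => A x /\ y = x); split.
- apply: determined_and; first exact: (determined_preimage fst hA).
  pose proof (determined_holds2 (fun (p : T * T) (_ : nat) => p.2 = p.1)
    (st 0 : Star nat)) as h.
  move: h; congr determined; apply/funext => p /=.
  have [g [-> ->]] := germ2 p (st 0 : Star nat).
  by rewrite holds2_germ !smap_comp smap_eq.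
- by move=> x y [Ax ->]; split=> //; exact: AB.
- by move=> x Ax; exists x.
- by move=> x y y' [_ ->] [_ ->].
- by move=> x x' y [_ ->] [_ ->].
Qed.

Section Infinite.
Variable d : Star nat.
Hypothesis dinf : forall n, d <> st n.

Lemma le_infinite n : holds (fun t => n <= t) d.
Proof.
have : ~ holds (fun t => t < n) d by move=> /lt_st[k _ /dinf].
by rewrite -holds_not; apply: holds_imp => t; lia.
Qed.

Definition below : set (Star nat) :=
  [set x | holds2 (fun d x => x < 2 ^ d) d x].

(** This is c/N for c equal to [2 ^ d]; the successor keeps the divisor positive. Likewise [halo]
    says that two points differ by an element of c/N. *)
Definition small : set (Star nat) :=
  [set x | forall n, holds2 (fun d x => x <= 2 ^ d %/ n.+1) d x].

Definition halo (x e : Star nat) : Prop :=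
  forall n, holds3 (fun d x e => dist x e <= 2 ^ d %/ n.+1) d x e.

(** Only digits with standard index are kept, so that [hbit x] is an ordinary point of Cantor space;
    [digits G] below becomes M_G when numbers are replaced by their digit functions. *)
Definition hbit (x : Star nat) (i : nat) : bool :=
  `[< holds2 (fun d x => bit d x i) d x >].

Definition digits (G : set (nat -> bool)) : set (Star nat) :=
  [set x | below x /\ G (hbit x)].

Lemma determined_below : determined below.
Proof.
rewrite (_ : below = [set x | holds2 (fun x d => x < 2 ^ d) x d]).
  exact: determined_holds2.
apply/funext => x; rewrite /below /=; have [g [-> ->]] := germ2 d x.
by rewrite !holds2_germ.
Qed.

Lemma determined_hbit i : determined (fun x => is_true (hbit x i)).
Proof.
rewrite (_ : (fun x => _) = [set x | holds2 (fun x d => bit d x i) x d]).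
  exact: determined_holds2.
apply/funext => x; rewrite /hbit /= asboolE; have [g [-> ->]] := germ2 d x.
by rewrite !holds2_germ.
Qed.

Lemma determined_digits G : determined (digits G).
Proof.
apply: (@determined_countable _ _ _ _ (option nat)
  (fun k => if k is Some i then (fun x => is_true (hbit x i)) else below)).
  by case=> [i|]; [exact: determined_hbit|exact: determined_below].
move=> x y xy [bx Gx]; split; first exact/(xy None).
rewrite (_ : hbit y = hbit x) //; apply/funext => i.
by apply/idP/idP => /(xy (Some i)).
Qed.

Lemma determined_halo e : determined (halo ^~ e).
Proof.
apply: (@determined_countable _ _ _ _ nat (fun n => [set x |
    holds3 (fun d x e => dist x e <= 2 ^ d %/ n.+1) d x e])).
  move=> n; rewrite (_ : [set x | _] = [set x | holds2
    (fun x (p : nat * nat) => dist x p.2 <= 2 ^ p.1 %/ n.+1) x (spair d e)]).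
    exact: determined_holds2.
  apply/funext => x /=; have [g [-> -> ->]] := germ3 d x e.
  by rewrite spair_germ holds2_germ holds3_germ.
by move=> x y xy xe n; apply: (xy n).1; exact: xe.
Qed.

(** Finitely many standard digits can be compared in a single internal statement, to which transfer
    applies. *)
Lemma hbit_eq x y n : hbit x = hbit y ->
holds3 (fun d x y => forall i, i < n -> bit d x i = bit d y i) d x y.
Proof.
move=> xy; apply: holds_nat_all => i _; move: (congr1 (@^~ i) xy) => /= e.
have : holds2 (fun d x => bit d x i) d x <-> holds2 (fun d x => bit d x i) d y.
  by move: e; rewrite /hbit => e; split=> /asboolP;
    [rewrite e|rewrite -e] => /asboolP.
have [g [-> -> ->]] := germ3 d x y; rewrite !holds2_germ.
rewrite !spair_germ !holds_germ /=.
case: (pselect (holds (fun t => bit t.1.1 t.2 i) g)) => h h1.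
  by apply: holds_imp2 h (h1.2 h) => t -> ->.
have h2 : ~ holds (fun t => bit t.1.1 t.1.2 i) g by move=> /h1.
move: h h2; rewrite -!holds_not; apply: holds_imp2 => t.
by move=> /negP/negbTE -> /negP/negbTE ->.
Qed.

(** The first [n] digits settle the radius [2 ^ d %/ n.+1], because [n < 2 ^ n]; as [d] is infinite,
    there are at least [n] digits. *)
Lemma hbit_halo x y : below x -> below y -> hbit x = hbit y -> halo x y.
Proof.
move=> bx byy xy n; have h := hbit_eq n xy.
move: h bx byy (le_infinite n); rewrite /below /=;
  have [g [-> -> ->]] := germ3 d x y.
rewrite !holds2_germ !holds3_germ holds_germ.
apply: holds_imp4 => t h bx byy nd.
apply: (@eq_div_dist _ n) => //; first by rewrite ltn_expl.
exact: eq_bit_div.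
Qed.

Definition sadd (x y : Star nat) := smap2 addn x y.

(** Countably many halos fit into the one copy [x0] + c/N: each is shifted to 0, folded by [zigzag]
    and kept apart from the others by the power of two. Points outside all halos stay fixed. *)
Lemma absorption (A : set (Star nat)) (e : nat -> Star nat) (x0 : Star nat) :
  determined A -> (forall k, small k -> exists i, halo (sadd x0 k) (e i)) ->
  sle A [set y | (A y /\ forall i, ~ halo y (e i)) \/
                 exists2 k, small k & y = sadd x0 k].
Proof.
move=> hA hx0.
pose sel (p : nat -> bool) : option nat :=
  if pselect (exists i, p i) is left h then Some (ex_minn h) else None.
have selS p i : sel p = Some i -> p i.
  by rewrite /sel; case: pselect => // h [<-]; case: ex_minnP.
have selN p i : sel p = None -> ~ p i.
  by rewrite /sel; case: pselect => // n _ pi; apply: n; exists i.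
pose sx x := sel (fun i => `[< halo x (e i) >]).
(* The index is the least [i] whose halo contains the point, or [None]. The identity is written with
   a dummy parameter to fit [determined2_fun]. *)
pose (f := fun (k : option nat) (x : Star nat) => if k is Some i then
  smap2 (fun x (p : nat * nat) => p.1 + 2 ^ i * (zigzag x p.2).*2.+1)
    x (spair x0 (e i)) else smap2 (fun x (_ : nat) => x) x x0).
pose (z := fun i x => smap2 (fun x e => 2 ^ i * (zigzag x e).*2.+1) x (e i)).
have fS i x : f (Some i) x = sadd x0 (z i x).
  rewrite /f /z /sadd; have [g [-> -> ->]] := germ3 x x0 (e i).
  by rewrite spair_germ !smap2_germ.
have fN x : f None x = x.
  by rewrite /f; have [g [-> ->]] := germ2 x x0; rewrite smap2_germ.
have zsmall i x : halo x (e i) -> small (z i x).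
  (* These are the two bounds of [pow2_zigzag_le], the second one obtained from [d < 2 ^ d]. *)
  move=> h n; have := h (2 ^ i * 8 * n.+1).-1;
    have := le_infinite (2 ^ i * 6 * n.+1).
  rewrite /z; have [g [-> -> ->]] := germ3 d x (e i).
  rewrite smap2_germ holds2_germ holds3_germ holds_germ.
  apply: holds_imp2 => t h1 h2; apply: (pow2_zigzag_le h2).
  by apply: (leq_trans h1); rewrite ltnW // ltn_expl.
have zinj i j x y : sadd x0 (z i x) = sadd x0 (z j y) -> i = j.
  rewrite /z /sadd; have [g [-> -> ->]] := germ3 x0 x (e i).
  have [g' [-> -> ->]] := germ3 g y (e j).
  rewrite !smap_comp !smap2_germ smap_eq => h.
  have [//|ij] := pselect (i = j).
  by case: (@holds_false _ _ g');
    apply: holds_imp h => t /= /addnI/pow2_odd_inj[/ij].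
have zinj2 i x y : sadd x0 (z i x) = sadd x0 (z i y) -> x = y.
  rewrite /z /sadd; have [g [-> -> ->]] := germ3 x0 x (e i).
  have [g' [-> ->]] := germ2 g y.
  rewrite !smap_comp !smap2_germ !smap_eq; apply: holds_imp => t.
  by move=> /addnI/pow2_odd_inj[_ /zigzag_inj].
apply: (@sle_piecewise _ _ _ _ _ _ (option nat) _ _ sx f).
- move=> k; apply: (@determined_countable _ _ _ _ (option nat)
    (fun k => if k is Some i then halo ^~ (e i) else A)).
    by case=> [i|//]; exact: determined_halo.
  move=> x y xy [Ax <-]; split; first exact/(xy None).
  congr sel; apply/funext => i; apply: asbool_equiv_eq.
  exact: (iff_sym (xy (Some i))).
- by case=> [i|]; exact: determined2_fun.
- move=> x Ax; case sxE : (sx x) => [i|].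
    right; rewrite fS; exists (z i x) => //; apply: zsmall.
    by have /asboolP := selS _ _ sxE.
  by left; rewrite fN; split=> // i h; apply: (selN _ i sxE); exact/asboolP.
(* A fixed point never meets an image of a moved one: such images lie in [x0] + c/N, which the halos
   cover, while fixed points avoid every halo. *)
have no x i y j : sx x = None -> sx y = Some j -> x = sadd x0 (z i y) ->
  halo y (e i) -> False.
  move=> sx0 _ xE /zsmall/hx0[k]; rewrite -xE => h.
  by apply: (selN _ k sx0); exact/asboolP.
move=> x x' _ _; case sxE : (sx x) => [i|]; case sx'E : (sx x') => [j|];
  rewrite ?fS ?fN //.
- move=> h; have ij := zinj _ _ _ _ h; subst j; exact: zinj2 h.
- move=> /esym h; exfalso; apply: (no _ _ _ _ sx'E sxE h).
  by have /asboolP := selS _ _ sxE.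
- move=> h; exfalso; apply: (no _ _ _ _ sxE sx'E h).
  by have /asboolP := selS _ _ sx'E.
Qed.

End Infinite.
End Hypernaturals.

(** * Nondecreasing internal functions with standardly many values *)

Section MonotoneFunctions.
Variables (V : superstructure) (I : nonstandard_universe V).
Local Notation Star := (Star I).

Definition sapp (f : Star (nat -> nat)) (x : Star nat) : Star nat :=
  smap2 (fun x f => f x) x f.

Variable d : Star nat.
Hypothesis dinf : forall n, d <> st n.

Definition smono (f : Star (nat -> nat)) : Prop :=
  holds2 (fun d f => forall x y, x <= y -> y < 2 ^ d -> f x <= f y) d f.

Definition sbounded (f : Star (nat -> nat)) (k : nat) : Prop :=
  holds2 (fun d f => forall x, x < 2 ^ d -> f x < k) d f.

Lemma smono_cut f v : smono f -> exists e : Star nat, forall x, below d x ->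
  holds2 (fun x e => x < e) x e <-> holds (fun t => t < v) (sapp f x).
Proof.
move=> fmono.
have [e he] : exists e : Star nat, holds3 (fun d f e =>
    forall x, x < 2 ^ d -> (x < e) = (f x < v)) d f e.
  move: fmono; rewrite /smono; have [g [-> ->]] := germ2 d f; rewrite holds2_germ.
  move=> h; pose P (t : nat * (nat -> nat)) e :=
    forall x, x < 2 ^ t.1 -> (x < e) = (t.2 x < v).
  have /holds_ex[e he] : holds (fun t => exists e, P t e) g.
    by apply: holds_imp h => t; exact: monotone_cut.
  exists e; move: he; have [g' [-> ->]] := germ2 g e.
  by rewrite !smap_comp holds2_germ holds3_germ.
exists e => x; move: he; rewrite /sapp /below /=.
have [g [-> -> ->]] := germ3 d f e; have [g' [-> ->]] := germ2 g x.
rewrite !smap_comp smap2_germ !holds2_germ holds3_germ holds_germ => h1 h2.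
by split; apply: holds_imp3 h1 h2 => t ht /ht /= ->.
Qed.

(** Each level set is the interval between two cuts. A point outside the halos of all cuts keeps a
    distance of order c/n, with [n] standard, from both ends of its level set. *)
Lemma smono_locally_cst f k : smono f -> sbounded f k ->
  exists e : nat -> Star nat, forall x, below d x ->
    (forall v, ~ halo d x (e v)) ->
  exists n, forall y, below d y ->
    holds3 (fun d x y => dist x y <= 2 ^ d %/ n.+1) d x y -> sapp f y = sapp f x.
Proof.
move=> fmono fk; have /choice[e he] := fun v => smono_cut v fmono.
exists e => x bx ne.
have [v vk xv] : exists2 v, v < k & sapp f x = st v.
  apply: lt_st; move: bx fk; rewrite /below /sbounded /sapp /=.
  have [g [-> -> ->]] := germ3 d f x.
  rewrite smap2_germ !holds2_germ holds_germ.
  by apply: holds_imp2 => t xd; apply.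
have far w : exists n, ~ holds3 (fun d x y =>
  dist x y <= 2 ^ d %/ n.+1) d x (e w).
  by apply/existsNP; exact: ne.
(* The cuts at [v] and [v.+1] bound the level set of the value [v]; the larger index gives a radius
   that crosses neither. *)
have [n1 far1] := far v; have [n2 far2] := far v.+1.
exists (maxn n1 n2) => y by_ xy.
have side n w : n <= maxn n1 n2 ->
    ~ holds3 (fun d x y => dist x y <= 2 ^ d %/ n.+1) d x (e w) ->
    holds (fun t => t < w) (sapp f x) <-> holds (fun t => t < w) (sapp f y).
  move=> nn; rewrite -(he w x bx) -(he w y by_).
  move: xy; have [g [-> -> -> ->]] := germ4 d x y (e w).
  rewrite !holds2_germ !holds3_germ => h; rewrite -holds_not => h'.
  have nm t : 2 ^ t %/ (maxn n1 n2).+1 <= 2 ^ t %/ n.+1 by exact: leq_div2l.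
  by split; apply: holds_imp3 h h' => t h1 /negP h2;
    move: h1 h2 (nm t.1.1.1); rewrite /dist; lia.
have lo : ~ holds (fun t => t < v) (sapp f y).
  rewrite -(side n1 v) ?leq_maxl // xv holds_st; lia.
have hi : holds (fun t => t < v.+1) (sapp f y).
  by rewrite -(side n2 v.+1) ?leq_maxr // xv holds_st.
rewrite xv -holds_eq_st; move: lo hi; rewrite -holds_not; apply: holds_imp2 => t.
by lia.
Qed.

End MonotoneFunctions.

Section MonotoneCase.
Variables (V : superstructure) (I : nonstandard_universe V).
Local Notation Star := (Star I).
Variable d : Star nat.
Hypothesis dinf : forall n, d <> st n.

(** The number formed by the first [k] digits; it jumps exactly at the multiples of
    [2 ^ (d - k)]. *)
Definition leading (k : nat) : Star (nat -> nat) :=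
  smap (fun d x => x %/ 2 ^ (d - k)) d.

Lemma smono_leading k : smono d (leading k).
Proof.
rewrite /smono /leading {1}(germ1 d) holds2_germ.
by apply: holdsT => t x y xy _; exact: leq_div2r.
Qed.

Lemma sbounded_leading k : sbounded d (leading k) (2 ^ k).
Proof.
rewrite /sbounded /leading {1}(germ1 d) holds2_germ.
apply: holdsT => t x; rewrite ltn_divLR ?expn_gt0 // -expnD => xt.
by apply: (leq_trans xt); rewrite leq_pexp2l //; lia.
Qed.

Lemma hbit_leading x i :
  hbit d x i = `[< holds odd (sapp (leading i.+1) x) >].
Proof.
congr asbool; rewrite /sapp /leading; have [g [-> ->]] := germ2 d x.
by rewrite smap_comp smap2_germ holds2_germ holds_germ.
Qed.

(** Distance from the endpoint [2 ^ d] keeps the sum below it, and local constancy of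
    [leading i.+1], whose parity is digit [i], preserves the standard digits. *)
Lemma hbit_add x k : below d x -> ~ halo d x (smap (expn 2) d) ->
  (forall m, exists n, forall y, below d y ->
    holds3 (fun d x y => dist x y <= 2 ^ d %/ n.+1) d x y ->
    sapp (leading m) y = sapp (leading m) x) ->
  small d k -> below d (sadd x k) /\ hbit d (sadd x k) = hbit d x.
Proof.
move=> bx /existsNP[n hn] lc sk.
have byk : below d (sadd x k).
  move: bx hn (sk n); rewrite /below /sadd /=.
  have [g [-> -> ->]] := germ3 d x k.
  rewrite smap_comp smap2_germ !holds2_germ holds3_germ -holds_not.
  by apply: holds_imp3 => t xd /negP; rewrite /dist /=; lia.
split=> //; apply/funext => i; rewrite !hbit_leading.
have [m ->] := lc i.+1; [by []|exact: byk|].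
move: (sk m); rewrite /sadd; have [g [-> -> ->]] := germ3 d x k.
rewrite smap2_germ !holds2_germ holds3_germ; apply: holds_imp => t.
by rewrite /dist; lia.
Qed.

Lemma halo_add x k : small d k -> halo d (sadd x k) x.
Proof.
move=> sk n; move: (sk n); rewrite /sadd; have [g [-> -> ->]] := germ3 d x k.
rewrite smap2_germ !holds2_germ holds3_germ; apply: holds_imp => t.
by rewrite /dist; lia.
Qed.

(** Near a point far from all jumps, both the functions [f m] and the standard digits are locally
    constant. One such point in [X] provides a copy of c/N that absorbs the rest of [X]. *)
Lemma monotone_dichotomy (X : set (Star nat)) (f : nat -> Star (nat -> nat))
    (K : nat -> nat) :
  determined X -> X `<=` below d -> (forall m, smono d (f m)) ->
  (forall m, sbounded d (f m) (K m)) ->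
  (forall x y, below d x -> below d y ->
     (forall m, sapp (f m) y = sapp (f m) x) -> X x -> X y) ->
  sle X (small d) \/
  exists G, sle X (digits d G) /\ sle (digits d G) X.
Proof.
move=> hX Xd fmono fK fX.
pose F (k : nat + nat) := match k with inl m => f m | inr m => leading m end.
have /choice[e he] : forall k : nat + nat, exists e : nat -> Star nat,
    forall x, below d x -> (forall v, ~ halo d x (e v)) ->
    exists n, forall y, below d y ->
    holds3 (fun d x y => dist x y <= 2 ^ d %/ n.+1) d x y ->
    sapp (F k) y = sapp (F k) x.
  by case=> m; [exact: smono_locally_cst (fmono m) (fK m)|
    exact: smono_locally_cst (smono_leading m) (sbounded_leading m)].
(* The cuts only describe points below [2 ^ d], so the endpoint itself is excluded separately. *)
pose far x := (forall k v, ~ halo d x (e k v)) /\ ~ halo d x (smap (expn 2) d).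
(* One sequence lists all cuts and the endpoint. It also lists [x0], which puts [x0] + c/N inside
   one of the halos, as [absorption] requires. *)
pose e' x0 n := match (unpickle n : option (option (option ((nat + nat) *
  nat)))) with
  | Some (Some (Some p)) => e p.1 p.2
  | Some (Some None) => smap (expn 2) d
  | _ => x0 end.
have far_e' x0 x : (forall i, ~ halo d x (e' x0 i)) -> far x.
  move=> h; split=> [k v|].
    by have := h (pickle (Some (Some (k, v)))); rewrite /e' pickleK.
  by have := h (pickle (Some (None : option ((nat + nat) * nat))));
    rewrite /e' pickleK.
have abs x0 : sle X [set y | (X y /\ far y) \/
    exists2 k, small d k & y = sadd x0 k].
  have := @absorption _ _ d dinf X (e' x0) x0 hX.
  move=> h; apply: sle_subr (h _).
    by move=> y [[Xy /far_e']|]; [left|right].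
  move=> k sk; exists (pickle (None : option (option ((nat + nat) * nat)))).
  by rewrite /e' pickleK; exact: halo_add.
have [[x0 [Xx0 fx0]]|no] := pselect (exists x, X x /\ far x); last first.
  (* Without a far point in [X] only the translate of c/N remains; translating by 0 gives c/N
     itself. *)
  left; apply: sle_subr (abs (st 0)) => y [Xy|[k sk ->]].
    by case: no; exists y.
  rewrite (_ : sadd (st 0) k = k) // /sadd [k in RHS]germ1.
  by rewrite [k in LHS]germ1 (st_germ 0 k) smap2_germ.
(* Far points of [X] have digits in this set by definition, and the points of [x0] + c/N share the
   digits of [x0]. *)
right; exists [set g | exists x, [/\ X x, far x & g = hbit d x]]; split.
  apply: sle_subr (abs x0) => y [[Xy fy]|[k sk ->]].
    by split; [exact: Xd|exists y].
  have [|by_ yx] := @hbit_add x0 k (Xd _ Xx0) fx0.2 _ sk.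
    move=> m; apply: (he (inr m)); [exact: Xd|exact: (fx0.1 (inr m))].
  by split=> //; exists x0.
apply: sle_sub; first exact: determined_digits.
(* Here there is even inclusion: a point with the digits of a far [x] in [X] lies in the halo of
   [x], where every [f m] keeps its value. *)
move=> y [by_ [x [Xx fx yx]]]; apply: (fX x y) => //; first exact: Xd.
move=> m; have [n hn] := he (inl m) x (Xd _ Xx) (fx.1 (inl m)).
by apply: hn => //; apply: (hbit_halo dinf) => //; exact: Xd.
Qed.

(** This exhibits c/N as a digit set. A point whose standard digits all vanish is in the halo of 0
    by [hbit_halo]. *)
Lemma small_digits : small d = digits d [set fun=> false].
Proof.
apply/seteqP; split=> x.
  move=> sx; split.
    move: (sx 1) (le_infinite dinf 1); rewrite /below /=.
    have [g [-> ->]] := germ2 d x; rewrite !holds2_germ holds_germ.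
    apply: holds_imp2 => t; case: t.1 => // n h _; apply: leq_ltn_trans h _.
    by rewrite ltn_Pdiv // expn_gt0.
  apply/funext => i; rewrite /hbit; apply/asboolP.
  (* This bounds [x] by [2 ^ (d - i.+2)], strictly below the place value [2 ^ (d - i.+1)] of digit
     [i]. *)
  move: (sx (2 ^ i.+2).-1) (le_infinite dinf i.+2).
  have [g [-> ->]] := germ2 d x; rewrite !holds2_germ holds_germ -holds_not.
  apply: holds_imp2 => t; rewrite prednK ?expn_gt0 // => h id; apply/negP.
  rewrite /bit divn_small //; apply: leq_ltn_trans h _.
  rewrite -{1}(subnK id) expnD mulnK ?expn_gt0 // ltn_exp2l //; lia.
move=> [bx x0] n.
have b0 : below d (st 0).
  rewrite /below /= [d]germ1 (st_germ 0 d) holds2_germ.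
  by apply: holdsT => t; rewrite expn_gt0.
have h0 : hbit d (st 0) = fun=> false.
  apply/funext => i; rewrite /hbit; apply/asboolP.
  rewrite [d]germ1 (st_germ 0 d) holds2_germ -holds_not.
  by apply: holdsT => t; rewrite /bit div0n.
have := hbit_halo dinf bx b0 (etrans x0 (esym h0)) n.
have [g [-> ->]] := germ2 d x; rewrite (st_germ 0 g) holds2_germ holds3_germ.
by apply: holds_imp => t; rewrite /dist subn0 sub0n addn0.
Qed.

End MonotoneCase.

Lemma sle_bijection (V : superstructure) (I : nonstandard_universe V) T U
    {eT : encodable V T} {eU : encodable V U} (A : set (Star I T))
    (B : set (Star I U)) (R : Star I T -> Star I U -> Prop) :
  determined2 R -> (forall x y, R x y -> A x /\ B y) ->
  (forall x, A x -> exists y, R x y) -> (forall y, B y -> exists x, R x y) ->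
  (forall x y y', R x y -> R x y' -> y = y') ->
  (forall x x' y, R x y -> R x' y -> x = x') -> sle A B /\ sle B A.
Proof.
move=> R1 R2 R3 R3' R4 R5; split; first by exists R.
exists (fun y x => R x y); split=> //; first exact: determined2_sym.
- by move=> y x /R2[].
- by move=> y x x'; exact: R5.
- by move=> y y' x; exact: R4.
Qed.

(** * Reduction to the monotone case by an internal permutation *)

Section Sorting.
Variables (V : superstructure) (I : nonstandard_universe V).
Local Notation Star := (Star I).
Hypothesis sat : countably_saturated I.
Variable d : Star nat.
Hypothesis dinf : forall n, d <> st n.

Definition sorts N (f s : nat -> nat) : Prop :=
  [/\ forall i, i < N -> s i < N,
    forall i j, i < N -> j < N -> s i = s j -> i = j,
    forall x, x < N -> exists2 i, i < N & s i = x
  & forall i j, i <= j -> j < N -> f (s i) <= f (s j)].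

Definition ssorts (f s : Star (nat -> nat)) : Prop :=
  holds3 (fun d f s => sorts (2 ^ d) f s) d f s.

(** The traces on the first [n] sets are read as binary digits, the first set giving the most
    significant one, so that numerical order is lexicographic order of traces. *)
Fixpoint key (a : nat -> Star (set nat)) (n : nat) : Star (nat -> nat) :=
  if n is m.+1 then
    smap2 (fun (f : nat -> nat) (A : set nat) x => (f x).*2 + `[< A x >])
      (key a m) (a m)
  else st (fun=> 0).

Lemma key_bounded a n : holds (fun f => forall x, f x < 2 ^ n) (key a n).
Proof.
elim: n => [|n IH] /=; first exact/holds_st.
move: IH; have [g [-> ->]] := germ2 (key a n) (a n).
rewrite smap2_germ !holds_germ; apply: holds_imp => t h x.
by have := h x; rewrite expnS; case: asbool; lia.
Qed.

Lemma sin_key a n x : sin x (a n) = holds odd (sapp (key a n.+1) x).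
Proof.
rewrite /sapp /=; have [g [-> -> ->]] := germ3 x (key a n) (a n).
rewrite smap2_germ smap2_germ sin_germ holds_germ; congr holds.
apply/funext => t; rewrite oddD odd_double /= oddb; apply/propext.
by split=> [?|/asboolP//]; exact/asboolP.
Qed.

(** Dropping the last binary digit preserves the weak order. *)
Lemma ssorts_keyS a n s : ssorts (key a n.+1) s -> ssorts (key a n) s.
Proof.
rewrite /ssorts /=; have [g [-> -> -> ->]] := germ4 d s (key a n) (a n).
rewrite smap2_germ !holds3_germ; apply: holds_imp => t [h1 h2 h3 h4]; split=> //.
by move=> i j ij jN; have := h4 i j ij jN; do 2!case: asbool; lia.
Qed.

Lemma ssorts_ex f : exists s, ssorts f s.
Proof.
have := @holdsT _ I _ _ (fun p : nat * (nat -> nat) => exists s,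
  sorts (2 ^ p.1) p.2 s) (spair d f) (fun p => sorting _ _).
move=> /holds_ex[s]; rewrite /ssorts => h; exists s; move: h.
have [g [-> -> ->]] := germ3 d f s.
by rewrite spair_germ holds2_germ holds3_germ.
Qed.

(** The internal sets [b n] of sorting permutations are nonempty and decrease with [n], so
    saturation gives a common element. *)
Lemma ssorts_keys a : exists s, forall n, ssorts (key a n) s.
Proof.
pose (b := fun n => smap2 (fun d f => [set s | sorts (2 ^ d) f s]) d (key a n)).
assert (bE : forall n s, sin s (b n) = ssorts (key a n) s).
  move=> n s; rewrite /b /ssorts; have [g [-> -> ->]] := germ3 d (key a n) s.
  by rewrite smap2_germ sin_germ holds3_germ.
have [|s hs] := @saturation V I _ _ sat b.
  move=> n; have [s hs] := ssorts_ex (key a n); exists s => i.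
  elim: n hs => [|n IH] hs; first by rewrite leqn0 => /eqP ->; rewrite bE.
  rewrite leq_eqVlt => /orP[/eqP->|]; first by rewrite bE.
  by rewrite ltnS; apply: IH; exact: ssorts_keyS.
by exists s => n; rewrite -bE.
Qed.

(** The preimage [X'] of [X] under the sorting permutation is equivalent to [X]. The sorted keys are
    nondecreasing, and they determine [X'], because the parity of key [n.+1] is membership in
    [a n]. *)
Lemma dichotomy_below (X : set (Star nat)) : determined X -> X `<=` below d ->
  sle X (small d) \/ exists G, sle X (digits d G) /\ sle (digits d G) X.
Proof.
move=> hX Xd; have [a ha] := hX; have [s hs] := ssorts_keys a.
pose X' := [set i | below d i /\ X (sapp s i)].
have hX' : determined X'.
  apply: determined_and; first exact: determined_below.
  exact: (determined_preimage2 (fun x f => f x) s hX).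
have s_inj i j : below d i -> below d j -> sapp s i = sapp s j -> i = j.
  move: (hs 0); rewrite /ssorts /below /sapp /=.
  have [g [-> -> -> ->]] := germ4 d s i j; rewrite (st_germ _ g).
  rewrite !smap2_germ !holds2_germ holds3_germ !smap_eq.
  by apply: holds_imp4 => t [_ h _ _]; exact: h.
have [XX' X'X] : sle X X' /\ sle X' X.
  apply: (@sle_bijection _ _ _ _ _ _ _ _
    (fun x i => [/\ below d i, X x & x = sapp s i])).
  - pose proof (determined2_sym
      (determined2_fun (fun x (f : nat -> nat) => f x) s)) as h1.
    pose proof (determined_preimage (@snd nat nat) (determined_below d)) as h2.
    pose proof (determined_preimage (@fst nat nat) hX) as h3.
    have := determined_and (determined_and h2 h3) h1.
    by congr determined; apply/funext => p /=; apply/propext; split=> [[[]]|[]].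
  - by move=> x i [bi Xx e]; split=> //; split=> //; rewrite -e.
  - move=> x Xx; have bx := Xd _ Xx.
    have [i [bi e]] : exists i : Star nat, below d i /\ x = sapp s i.
      move: (hs 0) bx; rewrite /ssorts /below /sapp /=.
      have [g [-> -> ->]] := germ3 d s x; rewrite (st_germ _ g).
      rewrite holds3_germ holds2_germ => h h'.
      have /holds_ex[i hi] : holds (fun t =>
        exists i, i < 2 ^ t.1.1 /\ t.2 = t.1.2 i) g.
        by apply: holds_imp2 h h' => t [_ _ h _] /h[i ? <-]; exists i.
      exists i; move: hi; have [g' [-> ->]] := germ2 g i.
      rewrite !smap_comp smap2_germ !holds2_germ smap_eq => h2.
      by split; apply: holds_imp h2 => t [].
    by exists i.
  - by move=> i [bi Xi]; exists (sapp s i).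
  - by move=> x i j [bi _ ->] [bj _]; exact: s_inj.
  - by move=> x x' i [_ _ ->] [_ _ ->].
have [||||h|[G [h1 h2]]] := @monotone_dichotomy _ _ d dinf X'
    (fun m => smap2 (fun s k x => k (s x)) s (key a m)) (fun m => 2 ^ m) hX'.
- by move=> i [].
- move=> m; move: (hs m); rewrite /ssorts /smono.
  have [g [-> -> ->]] := germ3 d s (key a m).
  rewrite smap2_germ holds2_germ holds3_germ.
  by apply: holds_imp => t [_ _ _ h] x y xy yN; exact: h.
- move=> m; move: (key_bounded a m); rewrite /sbounded.
  have [g [-> -> ->]] := germ3 d s (key a m).
  rewrite smap2_germ holds2_germ holds_germ.
  by apply: holds_imp => t h x _; exact: h.
- move=> i j bi bj ij [_ Xi]; split=> //; apply: ha Xi => n.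
  rewrite !sin_key; suff -> : sapp (key a n.+1) (sapp s j) =
    sapp (key a n.+1) (sapp s i) by [].
  move: (ij n.+1); rewrite /sapp.
  have [g [-> -> -> ->]] := germ4 i j s (key a n.+1).
  by rewrite !smap2_germ.
- by left; exact: sle_trans XX' h.
- by right; exists G; split; [exact: sle_trans XX' h1|exact: sle_trans h2 X'X].
Qed.

End Sorting.

(** * The Vitali embedding *)

Definition tail_equal (g h : nat -> bool) : Prop :=
  exists N, forall i, N <= i -> g i = h i.

Lemma tail_equal_sym g h : tail_equal g h -> tail_equal h g.
Proof. by move=> [N gh]; exists N => i /gh. Qed.

Lemma tail_equal_trans f g h : tail_equal f g -> tail_equal g h -> tail_equal f h.
Proof.
move=> [N fg] [M gh]; exists (maxn N M) => i; rewrite geq_max => /andP[Ni Mi].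
by rewrite fg // gh.
Qed.

(** A Vitali transversal: [xget] depends only on the tail class, so tail-equal sequences get the
    same representative. *)
Definition tail_repr (g : nat -> bool) : nat -> bool :=
  xget (fun=> false) [set h | tail_equal h g].

Lemma tail_reprP g : tail_equal g (tail_repr g).
Proof.
apply: tail_equal_sym; rewrite /tail_repr.
by apply: (@xgetPex _ (fun=> false) [set h | tail_equal h g]); exists g; exists 0.
Qed.

Lemma eq_tail_repr g h : tail_equal g h -> tail_repr g = tail_repr h.
Proof.
move=> gh; congr xget; apply/seteqP; split=> f /= fg.
  exact: tail_equal_trans gh.
exact: tail_equal_trans (tail_equal_sym gh).
Qed.

Definition tail_start (g : nat -> bool) : nat := sval (cid (tail_reprP g)).

Lemma tail_startP g i : tail_start g <= i -> g i = tail_repr g i.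
Proof. by rewrite /tail_start; case: cid => /= N; exact. Qed.

(** One position codes [q] together with the finite data needed to recover [g] from its
    representative. *)
Definition flip_pos (g : nat -> bool) (q : nat) : nat :=
  pickle (tail_start g, mkseq g (tail_start g), q).

Definition flip (g : nat -> bool) (q i : nat) : bool :=
  if i == flip_pos g q then ~~ tail_repr g i else tail_repr g i.

Definition flip_end (g : nat -> bool) (q : nat) : nat :=
  maxn (tail_start g) (flip_pos g q).+1.

Lemma flip_endP g q i : flip_end g q <= i -> flip g q i = g i.
Proof.
rewrite geq_max => /andP[si pi]; rewrite (tail_startP si) /flip ifN //.
by rewrite gtn_eqF.
Qed.

(** The flipped sequence is tail-equal to [g] and so determines the representative. It differs from
    it only at [flip_pos], which decodes to [q] and to the part of [g] before [tail_start]; from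
    there on [g] is the representative. *)
Lemma flip_inj g q g' q' : flip g q = flip g' q' -> g = g' /\ q = q'.
Proof.
move=> e; have gg' : tail_repr g = tail_repr g'.
  apply: eq_tail_repr; exists (maxn (flip_end g q) (flip_end g' q')) => i.
  rewrite geq_max => /andP[h h'].
  by rewrite -(flip_endP h) -(flip_endP h') e.
have : flip_pos g q = flip_pos g' q'.
  apply: contrapT => /eqP pp'; have := congr1 (@^~ (flip_pos g q)) e.
  rewrite /flip eqxx (negbTE pp') gg'; by case: tail_repr.
move=> /(pcan_inj pickleK)[ss' gs ->]; split=> //; apply/funext => i.
have [si|si] := leqP (tail_start g) i.
  by rewrite (tail_startP si) gg' -tail_startP // -ss'.
have := congr1 (nth false ^~ i) gs; rewrite !nth_mkseq //.
by rewrite -ss'.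
Qed.

Section Vitali.
Variables (V : superstructure) (I : nonstandard_universe V).
Local Notation Star := (Star I).
Variable d : Star nat.
Hypothesis dinf : forall n, d <> st n.

Definition multiples : set (Star nat) :=
  [set x | exists n, holds2 (fun d x => x < 2 ^ d * n) d x].

Lemma determined_multiples : determined multiples.
Proof.
apply: (@determined_countable _ _ _ _ nat (fun n => [set x |
    holds2 (fun x d => x < 2 ^ d * n) x d])).
  by move=> n; exact: determined_holds2.
have e n x : holds2 (fun d x => x < 2 ^ d * n) d x =
    holds2 (fun x d => x < 2 ^ d * n) x d.
  by have [g [-> ->]] := germ2 d x; rewrite !holds2_germ.
move=> x y xy [n xn]; exists n; rewrite e; apply: (xy n).1.
by rewrite /= -e.
Qed.

Definition rem (x : Star nat) : Star nat := smap2 (fun x d => x %% 2 ^ d) x d.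
Definition quo (x : Star nat) : Star nat := smap2 (fun x d => x %/ 2 ^ d) x d.

(** Overwrites the first [k.1] digits of the remainder by [k.2], with a standard [k]; all later
    digits, also those of nonstandard index, are kept. *)
Definition change (k : nat * seq bool) (x : Star nat) : Star nat :=
  smap2 (fun x d => num d (fun i =>
    if i < k.1 then nth false k.2 i else bit d (x %% 2 ^ d) i)) x d.

Lemma below_change k x : below d (change k x).
Proof.
rewrite /below /change /=; have [g [-> ->]] := germ2 d x.
by rewrite smap2_germ holds2_germ; apply: holdsT => t; exact: num_lt.
Qed.

Lemma hbit_change k x i :
  hbit d (change k x) i = if i < k.1 then nth false k.2 i else hbit d (rem x) i.
Proof.
move: (le_infinite dinf i.+1); rewrite /hbit /change /rem.
have [g [-> ->]] := germ2 d x; rewrite !smap2_germ !holds2_germ holds_germ => id.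
apply/asboolP/idP => [h|].
  case: ifP => ik.
    case ki : (nth false k.2 i) => //; case: (@holds_false _ _ _ _ g).
    by apply: holds_imp2 id h => t it; rewrite bit_num // ik ki.
  apply/asboolP; apply: holds_imp2 id h => t it.
  by rewrite bit_num // ik.
case: ifP => ik.
  by move=> h; apply: holds_imp id => t it; rewrite bit_num // ik.
by move=> /asboolP; apply: holds_imp2 id => t it h; rewrite bit_num // ik.
Qed.

(** The overwritten digits are standard ones and are supplied by the second hypothesis; the others
    survive in [change k x]. *)
Lemma change_inj k x y : change k x = change k y ->
  hbit d (rem x) = hbit d (rem y) ->
  rem x = rem y.
Proof.
move=> exy /(hbit_eq k.1); move: exy; rewrite /change /rem.
have [g [-> -> ->]] := germ3 d x y; rewrite !smap2_germ holds3_germ !smap_eq.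
apply: holds_imp2 => t e h; have p0 : 0 < 2 ^ t.1.1 by rewrite expn_gt0.
rewrite -(num_bit (ltn_pmod t.1.2 p0)) -(num_bit (ltn_pmod t.2 p0)).
apply: eq_num => i it; have [/h//|ki] := ltnP i k.1.
have := congr1 (bit t.1.1 ^~ i) e; rewrite !bit_num //.
by rewrite ltnNge ki.
Qed.

(** The standard digits of the remainder are replaced by their [flip] along the quotient, which is
    standard. This alters finitely many digits, so countably many maps [change k] suffice, and
    [flip_inj] recovers both the quotient and the old digits. *)
Lemma sle_multiples_below : sle multiples (below d).
Proof.
have hq x : exists q, multiples x -> quo x = st q.
  have [[n xn]|nx] := pselect (multiples x); last by exists 0.
  suff /lt_st[q _ ->] : holds (fun t => t < n) (quo x) by exists q.
  move: xn; rewrite /quo; have [g [-> ->]] := germ2 d x.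
  rewrite smap2_germ holds2_germ holds_germ; apply: holds_imp => t.
  by rewrite ltn_divLR ?expn_gt0 // mulnC.
pose q x := if pselect (exists q,
  quo x = st q) is left h then sval (cid h) else 0.
have {hq} qP x : multiples x -> quo x = st (q x).
  have [q' hq'] := hq x; rewrite /q => /hq' h; case: pselect => [h'|[]].
    by case: cid.
  by exists q'.
pose L x := flip_end (hbit d (rem x)) (q x).
pose k x := (L x, mkseq (flip (hbit d (rem x)) (q x)) (L x)).
have kE x : hbit d (change (k x) x) = flip (hbit d (rem x)) (q x).
  apply/funext => i; rewrite hbit_change /=; case: ifP => iL.
    by rewrite nth_mkseq.
  by rewrite flip_endP // leqNgt iL.
apply: (@sle_piecewise _ _ _ _ _ _ _ _ _ k change).
(* The piece containing [x] depends only on its quotient and on the standard digits of its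
   remainder, hence on countably many determined sets. *)
- move=> k0; apply: (@determined_countable _ _ _ _ (option (nat + nat))
    (fun j => match j with
      | Some (inl n) => [set x | quo x = st n]
      | Some (inr i) => [set x | hbit d (rem x) i]
      | None => multiples end)).
    case=> [[n|i]|].
    + pose proof (determined_holds2 (fun x d => x %/ 2 ^ d = n) d) as h.
      move: h; congr determined; apply/funext => x /=; rewrite -holds_eq_st /quo.
      have [g [-> ->]] := germ2 x d.
      by rewrite smap2_germ holds2_germ holds_germ.
    + exact: (determined_preimage2 (fun x d =>
      x %% 2 ^ d) d (determined_hbit d i)).
    + exact: determined_multiples.
  move=> x y xy [Mx <-]; have My : multiples y by exact/(xy None).
  split; first exact: My.
  have qq : q y = q x.
    apply: (@st_inj _ I); rewrite -(qP y My).
    by apply: (xy (Some (inl (q x)))).1; exact: qP.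
  have rr : hbit d (rem y) = hbit d (rem x).
    by apply/funext => i; apply/idP/idP => /(xy (Some (inr i))).
  by rewrite /k /L qq rr.
- by move=> k0; exact: determined2_fun.
- by move=> x _; exact: below_change.
- move=> x y Mx My e; have := kE x; rewrite e kE => /esym/flip_inj[rr qq].
  have kk : k x = k y by rewrite /k /L rr qq.
  have {rr} : rem x = rem y by move: e; rewrite kk => /change_inj; exact.
  have : quo x = quo y by rewrite (qP x Mx) (qP y My) qq.
  rewrite /rem /quo; have [g [-> -> ->]] := germ3 d x y.
  rewrite !smap2_germ !smap_eq; apply: holds_imp2 => t h1 h2.
  by rewrite (divn_eq t.1.2 (2 ^ t.1.1)) h1 h2 -divn_eq.
Qed.

Lemma dichotomy_multiples (sat : countably_saturated I) (X : set (Star nat)) :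
  determined X -> X `<=` multiples ->
  sle X (small d) \/ exists G, sle X (digits d G) /\ sle (digits d G) X.
Proof.
move=> hX XM; have [R [R1 R2 R3 R4 R5]] :=
  sle_trans sat (sle_sub hX XM) sle_multiples_below.
pose Y := [set y | exists x, R x y].
have [XY YX] : sle X Y /\ sle Y X.
  apply: (@sle_bijection _ _ _ _ _ _ _ _ R) => //.
  by move=> x y Rxy; split; [have [] := R2 _ _ Rxy|exists x].
have [||h|[G [h1 h2]]] := @dichotomy_below _ _ sat d dinf Y.
- exact: determined_range.
- by move=> y [x /R2[]].
- by left; exact: sle_trans XY h.
- by right; exists G; split; [exact: sle_trans XY h1|exact: sle_trans h2 YX].
Qed.

End Vitali.

(** * Internal binary functions *)

Definition binary_function (d : nat) (xi : set (nat * nat)) : Prop :=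
  (forall p, xi p -> p.1 < d /\ p.2 < 2) /\
  (forall i, i < d -> exists y, xi (i, y) /\ forall z, xi (i, z) -> y = z).

Definition bit_graph (d x : nat) : set (nat * nat) :=
  [set p | p.1 < d /\ p.2 = nat_of_bool (bit d x p.1)].

Lemma bit_graph_function d x : binary_function d (bit_graph d x).
Proof.
split=> [p [pd ->]|i id]; first by split=> //; case: bit.
by exists (nat_of_bool (bit d x i)); split=> // z [/= _ ->].
Qed.

Lemma bit_graph_surj d xi : binary_function d xi ->
  exists x, x < 2 ^ d /\ xi = bit_graph d x.
Proof.
(* The number is read off from the places where the function takes the value 1. *)
move=> [h1 h2]; exists (num d (fun i => `[< xi (i, 1) >])).
split; first exact: num_lt.
apply/seteqP; split=> [[i y] xy|[i y] [/= id ->]]; last first.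
  rewrite bit_num //; have [z [xz _]] := h2 i id.
  have [_ /=] := h1 _ xz; case: z xz => [|[|//]] xz _.
    case: asboolP => // x1.
  by rewrite asboolT.
have [/= id y2] := h1 _ xy; split=> //=; rewrite bit_num //.
have [z [xz uz]] := h2 i id; case: asboolP => [x1|x1] /=.
  by rewrite -(uz _ xy) (uz _ x1).
by case: y y2 xy {uz} => [|[|]].
Qed.

Lemma bit_graph_inj d x y : x < 2 ^ d -> y < 2 ^ d ->
  bit_graph d x = bit_graph d y -> x = y.
Proof.
move=> xd yd e; rewrite -(num_bit xd) -(num_bit yd); apply: eq_num => i id.
have : bit_graph d x (i, nat_of_bool (bit d x i)) by [].
by rewrite e => -[_ /nat_of_bool_inj].
Qed.

Section BinaryFunctions.
Variables (V : superstructure) (I : nonstandard_universe V).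
Local Notation Star := (Star I).

Section Connectives.
Context {T U : Type} {eT : encodable V T} {eU : encodable V U}.

Lemma holds_andE (P Q : T -> Prop) (x : Star T) :
  holds (fun t => P t /\ Q t) x = (holds P x /\ holds Q x).
Proof.
rewrite propeqE; split=> [h|[]]; last exact: holds_and.
by split; apply: holds_imp h => t [].
Qed.

Lemma holds_impE (P Q : T -> Prop) (x : Star T) :
  holds (fun t => P t -> Q t) x = (holds P x -> holds Q x).
Proof.
rewrite propeqE; split=> [h h'|h]; first by apply: holds_imp2 h h' => t; apply.
have [/h|] := pselect (holds P x); first by apply: holds_imp.
by rewrite -holds_not; apply: holds_imp => t.
Qed.

Lemma holds_exE (P : T -> U -> Prop) (x : Star T) :
  holds (fun t => exists u, P t u) x <-> exists y : Star U, holds2 P x y.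
Proof.
split=> [/holds_ex//|[y]]; have [g [-> ->]] := germ2 x y.
by rewrite holds2_germ holds_germ; apply: holds_imp => t h; eexists; exact: h.
Qed.

End Connectives.

(** Unfolds the extended predicate into quantifiers over hypernaturals, the shape in which [Xi] is
    stated. *)
Lemma holds_binary_function (d : Star nat) (xi : Star (set (nat * nat))) :
  holds2 binary_function d xi <->
  (forall p, sin p xi -> holds2 (fun i d => i < d) (smap fst p) d /\
     holds (fun y => y < 2) (smap snd p)) /\
  (forall i, holds2 (fun i d => i < d) i d -> exists y, sin (spair i y) xi /\
     forall z, sin (spair i z) xi -> y = z).
Proof.
have [g [-> ->]] := germ2 d xi; rewrite holds2_germ holds_andE.
rewrite !holds_all.
split=> -[h1 h2]; split=> [p|i]; move: (h1) (h2).
- move=> /(_ p) + _; have [g' [-> ->]] := germ2 g p.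
  by rewrite !smap_comp sin_germ !holds2_germ holds_germ holds_impE holds_andE.
- move=> _ /(_ i); have [g' [-> ->]] := germ2 g i.
  rewrite !smap_comp !holds2_germ holds_impE => h /h/holds_ex[y].
  have [g2 [-> ->]] := germ2 g' y; rewrite holds2_germ holds_andE => -[xy uy].
  exists (smap snd g2); rewrite !smap_comp spair_germ sin_germ; split=> // z.
  move: uy => /holds_all/(_ z); have [g3 [-> ->]] := germ2 g2 z.
  rewrite !smap_comp spair_germ sin_germ holds2_germ smap_eq holds_impE; exact.
- move=> /(_ p) + _; have [g' [-> ->]] := germ2 g p.
  by rewrite !smap_comp sin_germ !holds2_germ holds_germ holds_impE holds_andE.
- move=> _ /(_ i); have [g' [-> ->]] := germ2 g i.
  rewrite !smap_comp !holds2_germ holds_impE => h /h[y].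
  have [g2 [-> ->]] := germ2 g' y;
    rewrite !smap_comp spair_germ sin_germ => -[xy uy].
  apply/holds_exE; exists (smap snd g2); rewrite holds2_germ holds_andE.
  split=> //; apply/holds_all => z; move: (uy z).
  have [g3 [-> ->]] := germ2 g2 z.
  by rewrite !smap_comp spair_germ sin_germ holds2_germ smap_eq holds_impE.
Qed.

Section Digits.
Variable d : Star nat.
Hypothesis dinf : forall n, d <> st n.

Definition extensions (G : set (nat -> bool)) : set (Star (set (nat * nat))) :=
  [set xi | holds2 binary_function d xi /\
    exists2 g, G g & forall n, sin (st (n, nat_of_bool (g n))) xi].

Definition sbit_graph (x : Star nat) : Star (set (nat * nat)) :=
  smap2 (fun x d => bit_graph d x) x d.

Lemma sin_sbit_graph x n (b : bool) :
  sin (st (n, nat_of_bool b)) (sbit_graph x) <-> hbit d x n = b.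
Proof.
have -> : sin (st (n, nat_of_bool b)) (sbit_graph x) =
    holds2 (fun d x => bit d x n = b) d x.
  move: (le_infinite dinf n.+1); rewrite /sbit_graph.
  have [g [-> ->]] := germ2 d x.
  rewrite (st_germ _ g) smap2_germ sin_germ holds2_germ holds_germ => nd.
  rewrite propeqE; split; apply: holds_imp2 nd => t nt.
    by move=> [_ /nat_of_bool_inj].
  by move=> e; split=> //=; rewrite e.
rewrite /hbit; have [g [-> ->]] := germ2 d x; rewrite !holds2_germ.
case: b; split.
- by move=> h; apply/asboolP.
- by move=> /asboolP.
- move=> h; apply/asboolP; rewrite -holds_not.
  by apply: holds_imp h => t ->.
- by move=> /asboolP; rewrite -holds_not; apply: holds_imp => t /negP/negbTE.
Qed.

(** A hypernatural below [2 ^ d] corresponds to the internal function of its [d] digits, and its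
    standard digits are the values of that function at standard arguments. *)
Lemma digits_extensions G :
  sle (digits d G) (extensions G) /\ sle (extensions G) (digits d G).
Proof.
apply: (@sle_bijection _ _ _ _ _ _ _ _
  (fun x xi => digits d G x /\ xi = sbit_graph x)).
- pose proof (determined_preimage (@fst nat (set (nat * nat)))
    (determined_digits d G)) as h1.
  exact: determined_and h1 (determined2_fun (fun x d => bit_graph d x) d).
- move=> x _ [dx ->]; split=> //; split.
    rewrite /sbit_graph; have [g [-> ->]] := germ2 d x.
    rewrite smap2_germ holds2_germ; apply: holdsT => t.
    exact: bit_graph_function.
  by exists (hbit d x) => [|n]; [case: dx|apply/sin_sbit_graph].
- by move=> x dx; exists (sbit_graph x).
- move=> xi [xif [g Gg xig]].
  have [x [bx xE]] : exists x, below d x /\ xi = sbit_graph x.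
    have : holds (fun p : nat * set (nat * nat) =>
      exists x, x < 2 ^ p.1 /\ p.2 = bit_graph p.1 x) (spair d xi).
      by apply: holds_imp xif => t; exact: bit_graph_surj.
    move=> /holds_ex[x h]; exists x; move: h; rewrite /below /sbit_graph /=.
    have [g' [-> -> ->]] := germ3 d xi x.
    by rewrite spair_germ smap2_germ !holds2_germ smap_eq holds_andE.
  exists x; split=> //; split=> //; rewrite (_ : hbit d x = g) //.
  by apply/funext => n; apply/sin_sbit_graph; rewrite -xE.
- by move=> x xi xi' [_ ->] [_ ->].
- move=> x x' xi [[bx _] ->] [[bx' _]]; move: bx bx';
  rewrite /below /sbit_graph /=.
  have [g [-> -> ->]] := germ3 d x x'.
  rewrite !smap2_germ !holds2_germ !smap_eq; apply: holds_imp3 => t.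
  exact: bit_graph_inj.
Qed.

Lemma hltE (x : I) : hlt x (sval d) <->
  exists a : Star nat, x = sval a /\ holds2 (fun i d => i < d) a d.
Proof.
rewrite /hlt star_relE; split=> [[a [b [-> db h]]]|[a [-> h]]].
  by exists a; rewrite (val_Star_inj db).
by exists a, d.
Qed.

Lemma iappE (xi : Star (set (nat * nat))) (x y : I) : iapp (sval xi) x y <->
  exists a b : Star nat, [/\ x = sval a, y = sval b & sin (spair a b) xi].
Proof.
split=> [[p pxy pxi]|[a [b [-> -> h]]]]; last first.
  by exists (sval (spair a b)); [exact/spairP|exact/sinE].
have [q pq] := Star_set_sub pxi; exists (smap fst q), (smap snd q).
pose proof ((spairP (smap fst q) (smap snd q) _).2 erefl) as h.
rewrite spairE -pq in h; have [-> ->] := opair_inj pxy h.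
by split=> //; rewrite spairE; apply/sinE; rewrite -pq.
Qed.

(** Members of [Xi] are arbitrary internal sets in the universe; since they consist of pairs of
    hypernaturals, [Star_setP] places them in the extended power set. *)
Lemma XiE (z : I) : Xi (sval d) z <->
  exists xi : Star (set (nat * nat)), z = sval xi /\ holds2 binary_function d xi.
Proof.
split=> [[zi zp zf]|[xi [-> /holds_binary_function[h1 h2]]]].
  have [|xi zE] := @Star_setP V I (nat * nat) _ z zi.
    move=> p /zp[x [y [pxy /hltE[a [xa _]] yb]]].
    have [b yE] : exists b : Star nat, y = sval b.
      by case: yb => ->; [exists (st 0)|exists (st 1)].
    by exists (spair a b); apply/spairP; rewrite -xa -yE.
  subst z; exists xi; split=> //; apply/holds_binary_function; split=> [p|i id].
    rewrite -[p in sin p]spairE => /sinE/zp[x [y [pxy /hltE[a [xa ad]] yb]]].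
    pose proof ((spairP (smap fst p) (smap snd p) _).2 erefl) as h.
    have [e1 e2] := opair_inj pxy h.
    rewrite xa in e1; rewrite -(val_Star_inj e1); split=> //.
    have [k k2 kE] : exists2 k, k < 2 & smap snd p = st k.
      by case: yb => yE; [exists 0|exists 1] => //; apply: val_Star_inj;
        rewrite -e2 yE.
    by rewrite kE; exact/holds_st.
  have [|y [/iappE[a [b [ai yb ab]]] uy]] := zf (sval i).
    by apply/hltE; exists i.
  exists b; rewrite (val_Star_inj ai); split=> // z iz.
  by apply: val_Star_inj; rewrite -yb; apply: uy; apply/iappE; exists a, z.
split; first exact: Star_set_iset.
  move=> p /[dup] pxi /Star_set_sub[q pq]; rewrite pq in pxi *.
  have [qd q2] := h1 q ((sinE _ _).1 pxi).
  exists (sval (smap fst q)), (sval (smap snd q)); split.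
  - by apply/spairP; rewrite spairE.
  - by apply/hltE; exists (smap fst q).
  - have [[|[|//]] _ ->] := lt_st q2; [by left|by right].
move=> x /hltE[i [-> /h2[y [iy uy]]]]; exists (sval y); split.
  by apply/iappE; exists i, y.
move=> w /iappE[a [b [ia -> ab]]]; congr sval; apply: uy.
by rewrite (val_Star_inj ia).
Qed.

Lemma Mset_extensions G : Mset (sval d) G = sval @` extensions G.
Proof.
have e (xi : Star (set (nat * nat))) n m : iapp (sval xi) (std I n) (std I m) <->
    sin (st (n, m)) xi.
  rewrite iappE -spair_st; split=> [[a [b [na mb]]]|h];
    last by exists (st n), (st m).
  rewrite (_ : st n = a); last exact: val_Star_inj.
  by rewrite (_ : st m = b) //; exact: val_Star_inj.
apply/seteqP; split=> [z [g Gg [/XiE[xi [-> xif]] xig]]|_ [xi [xif [g Gg xig]]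
  <-]].
  by exists xi => //; split=> //; exists g => // n; apply/e.
exists g => //; split; first by apply/XiE; exists xi.
by move=> n; apply/e.
Qed.

Lemma cdivN_small : cdivN (sval (smap (expn 2) d)) = sval @` small d.
Proof.
apply/seteqP; split=> [z h|_ [x xs <-] n /= n0].
  have [y /star_funE[a [/val_Star_inj<- yE]] /star_relE[x [b [zx yb _]]]] :=
    h 1 isT.
  exists x => // n.
  have [w /star_funE[a' [/val_Star_inj<- wE]] /star_relE[x' [b' [zx' wb' h']]]] :=
    h n.+1 isT.
  have ex : x = x' by apply: val_Star_inj; rewrite -zx -zx'.
  have eb : b' = smap (divn^~ n.+1) (smap (expn 2) d).
    by apply: val_Star_inj; rewrite -wb' wE.
  move: h'; rewrite eb -ex; have [g [-> ->]] := germ2 d x.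
  by rewrite !smap_comp !holds2_germ.
exists (sval (smap (divn^~ n) (smap (expn 2) d))).
  by apply/star_funE; exists (smap (expn 2) d).
apply/star_relE; exists x, (smap (divn^~ n) (smap (expn 2) d)); split=> //.
move: (xs n.-1); rewrite prednK //; have [g [-> ->]] := germ2 d x.
by rewrite !smap_comp !holds2_germ.
Qed.

Lemma cmulN_multiples :
  cmulN (sval (smap (expn 2) d)) `<=` sval @` multiples d.
Proof.
move=> z [n _ [y /star_funE[a [/val_Star_inj<- yE]] /star_relE[x [b [zx yb h]]]]].
(* The segment up to c n is closed, whereas [multiples] uses a strict bound; the extra c, which is
   positive, makes up for it. *)
exists x => //; exists n.+1.
have eb : b = smap (muln^~ n) (smap (expn 2) d).
  by apply: val_Star_inj; rewrite -yb yE.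
move: h; rewrite eb; have [g [-> ->]] := germ2 d x.
rewrite !smap_comp !holds2_germ; apply: holds_imp => t /= h.
by rewrite (leq_ltn_trans h) // ltn_pmul2l ?expn_gt0.
Qed.

End Digits.
End BinaryFunctions.

Theorem theorem5p2 (V : superstructure) (I : nonstandard_universe V)
    (Isat : countably_saturated I) (d c : I)
    (hd : hnat d) (hc : hnat c) (hdc : hpow2 d c)
    (hcinf : forall n : nat, c <> std I n)
    (X : set I) (hX : CD X) (hXc : X `<=` cmulN c) :
  CD_lt X (cdivN c) \/
  exists G : set (nat -> bool), CD_equiv X (Mset d G).
Proof.
have /star_funE[D [dD cD]] := hdc; subst d c.
(* A standard exponent would make c standard. *)
have Dinf n : D <> st n.
  by move=> Dn; apply: (hcinf (2 ^ n)); rewrite Dn smap_st.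
pose (Y := [set x : Star I nat | X (sval x)]).
have XY : X = sval @` Y.
  apply/seteqP; split=> [z Xz|_ [x Xx <-]//].
  by have [x _ xz] := cmulN_multiples (hXc z Xz); exists x; rewrite /Y /= ?xz.
have hY : determined Y by apply: CD_determined; rewrite -XY.
have YM : Y `<=` multiples D.
  by move=> x Xx; have [y yM /val_Star_inj <-] := cmulN_multiples (hXc _ Xx).
have equivM G : sle Y (digits D G) -> sle (digits D G) Y ->
    CD_equiv X (Mset (sval D) G).
  move=> h1 h2; rewrite Mset_extensions XY.
  have [h3 h4] := digits_extensions Dinf G.
  by split; apply: sle_CD_le; [exact: sle_trans h1 h3|exact: sle_trans h4 h2].
rewrite cdivN_small {1}XY.
have [Ysmall|[G [h1 h2]]] := dichotomy_multiples Dinf Isat hY YM; last first.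
  by right; exists G; exact: equivM.
(* Here [X] embeds into c/N. If c/N embeds back, [X] is equivalent to M_G with [G] consisting of the
   zero sequence; otherwise the inequality is strict. *)
have [smallY|nsmallY] := pselect (sle (small D) Y).
  by right; exists [set fun=> false]; apply: equivM; rewrite -small_digits.
left; split; first exact: sle_CD_le.
by rewrite -XY => h; apply/nsmallY/CD_le_sle; rewrite -XY.
Qed.
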